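(* Let $\alpha>1$ and let $\Omega_{\alpha}\subset\mathbb R^2$ be the Hölder cusp domain, i.e. the image of the square $\Omega=\{(x,y):|x|+|y|\le1\}$ under the homeomorphism $$ \varphi(x,y)=\begin{cases}(x,y^\alpha), & y\ge0,\\ (x,-|y|^\alpha), & y<0.\end{cases} $$ Then the first non-trivial Neumann eigenvalue $\mu_1(\Omega_\alpha)$ of the Laplace operator in $\Omega_\alpha$ satisfies $$ \mu_1(\Omega_{\alpha}) \geq \frac{(\alpha+1)\alpha(2-\alpha)(3-\alpha)}{9\pi^3\alpha\left(\alpha+1 + \alpha(2-\alpha)(3-\alpha)\right)}. $$ In particular, if $\alpha = 4$, then $\mu_1(\Omega_{\alpha}) \geq (11.7\,\pi^3)^{-1}$.
   Context: The Neumann spectral problem in a bounded domain $\widetilde\Omega\subset\mathbb R^2$ is $-\Delta u=\mu u$ in $\widetilde\Omega$, $\partial u/\partial\nu=0$ on $\partial\widetilde\Omega$. By the Min-Max Principle, $\mu_1(\widetilde\Omega)=(B_{2,2}(\widetilde\Omega))^{-2}$, where $B_{2,2}(\widetilde\Omega)$ is the best constant in the Poincaré inequality $\inf_{c\in\mathbb R}\|g-c\mid L_2(\widetilde\Omega)\|\le B_{2,2}(\widetilde\Omega)\|\nabla g\mid L_2(\widetilde\Omega)\|$ over weakly differentiable $g$ with $\nabla g\in L_2(\widetilde\Omega)$. (The square and its image are taken as domains, i.e. up to their boundary.) *)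

(* Defs.v *)
From mathcomp Require Import all_boot all_order all_algebra.
From mathcomp Require Import all_classical all_reals all_analysis.
Import Order.TTheory GRing.Theory Num.Theory.
Import numFieldNormedType.Exports.

Set Implicit Arguments.
Unset Strict Implicit.
Unset Printing Implicit Defensive.

Local Open Scope classical_set_scope.
Local Open Scope ring_scope.

Section HolderCusp.
Context {R : realType}.

Definition rhombus : set (R * R) := [set p | `|p.1| + `|p.2| <= 1].

Definition holder_map (alpha : R) (p : R * R) : R * R :=
  if 0 <= p.2 then (p.1, p.2 `^ alpha) else (p.1, - (`|p.2| `^ alpha)).

(* The image of the closed square is closed; the domain is its interior. *)
Definition holder_cusp (alpha : R) : set (R * R) :=
  (holder_map alpha @` rhombus)°.

End HolderCusp.

Section Sobolev.
Context {R : realType}.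

Definition leb2 :
    {measure set (measurableTypeR R * measurableTypeR R)%type -> \bar R} :=
  (@lebesgue_measure R \x @lebesgue_measure R)%E.

Definition ex : R * R := (1, 0).
Definition ey : R * R := (0, 1).

Fixpoint Cn (n : nat) (f : R * R -> R) : Prop :=
  continuous f /\
  if n is m.+1 then
    [/\ forall p, derivable f p ex, forall p, derivable f p ey,
        Cn m (fun p => 'D_ex f p) & Cn m (fun p => 'D_ey f p)]
  else True.

Definition test_function (O : set (R * R)) (phi : R * R -> R) : Prop :=
  (forall n, Cn n phi) /\
  exists K : set (R * R),
    [/\ compact K, K `<=` O & forall p, ~ K p -> phi p = 0].

Definition L1loc (O : set (R * R)) (f : R * R -> R) : Prop :=
  measurable_fun (O : set (measurableTypeR R * measurableTypeR R)%type) f /\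
  forall K : set (R * R), compact K -> K `<=` O ->
    leb2.-integrable K (EFin \o f).

Definition L2 (O : set (R * R)) (f : R * R -> R) : Prop :=
  (f \_ O : (measurableTypeR R * measurableTypeR R)%type -> R)
    \in Lfun leb2 2%:E.

Definition L2norm (O : set (R * R)) (f : R * R -> R) : \bar R :=
  'N[leb2]_2%:E[EFin \o (f \_ O)]%E.

Definition weak_partial (O : set (R * R)) (e : R * R) (u w : R * R -> R) :=
  [/\ L1loc O u, L1loc O w & forall phi, test_function O phi ->
      \int[leb2]_(p in O) (u p * 'D_e phi p) =
      - \int[leb2]_(p in O) (w p * phi p)].

Definition weak_gradient (O : set (R * R)) (u : R * R -> R)
    (G : R * R -> R * R) : Prop :=
  weak_partial O ex u (fst \o G) /\ weak_partial O ey u (snd \o G).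

Definition L2_field (O : set (R * R)) (G : R * R -> R * R) : Prop :=
  L2 O (fst \o G) /\ L2 O (snd \o G).

Definition W12 (O : set (R * R)) (u : R * R -> R) (G : R * R -> R * R) : Prop :=
  [/\ L2 O u, weak_gradient O u G & L2_field O G].

Definition dot (a b : R * R) : R := a.1 * b.1 + a.2 * b.2.

(* Variational form of - Delta u = mu u with du/dnu = 0 on the boundary: the   *)
(* boundary condition is encoded by testing against all of W^{1,2}, not only  *)
(* against functions vanishing on the boundary.                               *)
Definition neumann_eigenvalue (O : set (R * R)) (mu : R) : Prop :=
  exists u G, [/\ W12 O u G,
    ~ {ae leb2, forall p, O p -> u p = 0} &
    forall v H, W12 O v H ->
      \int[leb2]_(p in O) dot (G p) (H p) =
      mu * \int[leb2]_(p in O) (u p * v p)].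

(* On a domain (connected) the trivial eigenvalue 0 is simple, so the first    *)
(* non-trivial eigenvalue is the least nonzero one.                           *)
Definition neumann_mu1 (O : set (R * R)) : \bar R :=
  ereal_inf [set mu%:E | mu in [set mu | neumann_eigenvalue O mu /\ mu != 0%R]].

Definition poincare_ineq (O : set (R * R)) (B : R) : Prop :=
  forall g G, weak_gradient O g G -> L2_field O G ->
    (ereal_inf [set L2norm O (fun p => g p - c)%R | c in [set: R]] <=
     B%:E * L2norm O (fun p => Num.sqrt (dot (G p) (G p))))%E.

Definition poincare_constant (O : set (R * R)) : \bar R :=
  ereal_inf [set B%:E | B in [set B | 0%R <= B /\ poincare_ineq O B]].

(* In \bar R, +oo ^-1 = 0 and 0 ^-1 = +oo. *)
Definition neumann_mu1_minmax (O : set (R * R)) : \bar R :=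
  ((poincare_constant O ^+ 2)^-1)%E.

End Sobolev.

(* Main.v *)
Require Import Defs.
From mathcomp Require Import all_boot all_order all_algebra.
From mathcomp Require Import all_classical all_reals all_analysis.
From mathcomp Require Import measurable_realfun ring lra.
Import Order.TTheory GRing.Theory Num.Theory.
Import numFieldNormedType.Exports.

(** The cusp is the set of points with |x| < lam y, where
    lam y = 1 - |y|^(1/alpha): its horizontal slices are intervals centred
    at 0 that shrink as |y| grows ([holder_cuspE]). On every such stack of
    shrinking intervals (a [profile]) the Poincare inequality

      inf_c ||u - c||^2 <= 192 ||grad u||^2

    holds, with a constant that does not see the shape of lam
    ([poincare_strips]). This is enough: the lower bound claimed for mu_1 is at
    most (6/5) / (9 pi^3), which is below 1/192 because pi >= 3. The same slack
    makes crude constants affordable throughout.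

    Why the constant does not see the cusp. Two generic points (x, y) and
    (x', y') are joined by the path that goes horizontally to (t, y),
    vertically to (t, y') and horizontally to (x', y'), where t runs through
    the shorter of the two slices. Averaging over t ([pair_bound]) bounds the
    contribution of the vertical piece by a multiple of
    ||grad u||^2 / min (lam y) (lam y'). This blows up near the tips, but it is
    integrated against the slice lengths 2 lam y and 2 lam y', and
    lam y * lam y' / min (lam y) (lam y') <= lam y + lam y'. A horizontal piece
    costs at most a multiple of lam y times the energy of its slice. With
    c = u (x', y') this estimates ||u - c||^2 ([sqr_dist_le]); averaging over y'
    with weight lam y' then gives the inequality. No mean value of u enters, so
    u need not be known to be square integrable.

    Why paths make sense for weak derivatives. Test the weak derivative against
    F(x) psi(y), where F' is a mean-zero combination of two smooth humps that
    sharpen to indicators of intervals while F stays bounded. In the limit this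
    compares the averages of u over two intervals, up to the integral of the
    absolute value of the weak derivative ([rect_limit]). Lebesgue
    differentiation turns averages into values: on almost every segment of a
    box, u differs from its mean by at most the integral of the absolute value
    of the derivative along the segment ([rect_ae]).

    The two readings of mu_1. The min-max value is the inverse square of the
    Poincare constant ([minmax_ge]). An eigenfunction for a nonzero eigenvalue
    is orthogonal to the constant 1, which is an admissible test function
    ([W12_cst1]); hence subtracting a constant from it cannot decrease its norm
    and the Poincare inequality bounds its Rayleigh quotient
    ([neumann_mu1_ge]). *)

Set Implicit Arguments.
Unset Strict Implicit.
Unset Printing Implicit Defensive.

Local Open Scope classical_set_scope.
Local Open Scope ring_scope.

(** * Smooth functions on the line *)

Section Smooth.
Context {R : realType}.
Implicit Types f g : R -> R.

(** The derivative is quantified rather than computed, so that closure under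
    sums, products and primitives needs no equation between derivatives. *)
Fixpoint Ck (n : nat) (f : R -> R) : Prop :=
  if n is m.+1 then
    exists2 df : R -> R, (forall x, is_derive x (1 : R) f (df x)) & Ck m df
  else continuous f.

Definition smooth f := forall n, Ck n f.

Lemma is_derive_continuous f (df : R -> R) :
  (forall x, is_derive x (1 : R) f (df x)) -> continuous f.
Proof.
move=> fdf x; apply: differentiable_continuous; apply/derivable1_diffP.
by have [] := fdf x.
Qed.

Lemma Ck_continuous n f : Ck n f -> continuous f.
Proof. by case: n => [//|n] [df fdf _]; exact: is_derive_continuous fdf. Qed.

Lemma CkW n f : Ck n.+1 f -> Ck n f.
Proof.
elim: n f => [|n IH] f [df fdf Hdf]; first exact: is_derive_continuous fdf.
by exists df => //; exact: IH.
Qed.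

Lemma CkD n f g : Ck n f -> Ck n g -> Ck n (fun x => f x + g x).
Proof.
elim: n f g => [|n IH] f g /=.
  by move=> cf cg x; apply: cvgD; [exact: cf|exact: cg].
move=> [df fdf Hdf] [dg gdg Hdg]; exists (fun x => df x + dg x); last exact: IH.
by move=> x; apply: is_deriveD.
Qed.

Lemma Ck_cst n (c : R) : Ck n (fun=> c).
Proof.
elim: n c => [|n IH] c /=; first by move=> x; exact: cvg_cst.
by exists (fun=> 0); [move=> x; exact: is_derive_cst|exact: IH].
Qed.

Lemma CkM n f g : Ck n f -> Ck n g -> Ck n (fun x => f x * g x).
Proof.
elim: n f g => [|n IH] f g.
  by move=> cf cg x; apply: cvgM; [exact: cf|exact: cg].
move=> Hf Hg; have [Hf' Hg'] := (CkW Hf, CkW Hg).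
move: Hf Hg => [df fdf Hdf] [dg gdg Hdg].
exists (fun x => f x * dg x + g x * df x); last by apply: CkD; exact: IH.
by move=> x; apply: is_deriveM.
Qed.

Lemma Ck_affine n f (a b : R) : Ck n f -> Ck n (fun x => f (a * x + b)).
Proof.
have H x : is_derive x (1 : R) (fun x : R => a * x + b) a.
  rewrite [X in is_derive _ _ _ X](_ : a = a *: 1 + 0); last first.
    by rewrite addr0 [_ *: _]mulr1.
  by apply: is_deriveD; apply: is_deriveZ.
elim: n f => [|n IH] f /=.
  move=> cf; have := is_derive_continuous H => ca x.
  by apply: continuous_comp; [exact: ca|exact: cf].
move=> [df fdf Hdf]; exists (fun x => df (a * x + b) * a).
  by move=> x; apply: (@is_derive1_comp _ f (fun x => a * x + b)).
by apply: CkM; [exact: IH|exact: Ck_cst].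
Qed.

(** The functions x^-k exp (-1/x), extended by 0 to x <= 0. The derivatives of
    exp (-1/x) are linear combinations of them. *)
Definition flat (k : nat) (x : R) : R :=
  if x <= 0 then 0 else x^-1 ^+ k * expR (- x^-1).

(** With u = 1/x this says u^(k+1) <= (k+1)^(k+1) exp u, the power k+1 of the
    inequality 1 + v <= exp v at v = u / (k+1). It controls the difference
    quotient at 0. *)
Lemma flat_bound k x : 0 < x -> 0 <= flat k x <= (k.+1)%:R ^+ k.+1 * x.
Proof.
move=> x0; rewrite /flat (leNgt x 0) x0/=; set u := x^-1.
have u0 : 0 < u by rewrite invr_gt0.
apply/andP; split; first by rewrite mulr_ge0 ?exprn_ge0 ?expR_ge0 ?ltW.
have k0 : 0 < (k.+1)%:R :> R by rewrite ltr0n.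
have H : (u / (k.+1)%:R) ^+ k.+1 <= expR u.
  have -> : expR u = expR (u / (k.+1)%:R) ^+ k.+1.
    by rewrite -expRM_natl; congr expR; field; rewrite gt_eqF.
  rewrite lerXn2r ?nnegrE ?expR_ge0 ?divr_ge0 ?ltW//.
  by apply: lt_le_trans (expR_ge1Dx _); rewrite ltrDr.
rewrite expRN ler_pdivrMr ?expR_gt0//.
apply: le_trans (_ : (k.+1)%:R ^+ k.+1 * x * (u / (k.+1)%:R) ^+ k.+1 <= _).
  rewrite le_eqVlt; apply/orP; left; apply/eqP.
  have m0 : (k.+1)%:R ^+ k.+1 != 0 :> R by rewrite expf_neq0// gt_eqF.
  have gen (M U : R) : M != 0 -> U = M * x * (x^-1 * U / M).
    by move=> M0; field; rewrite M0 gt_eqF.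
  by rewrite expr_div_n [u ^+ k.+1]exprS; exact: gen.
by rewrite ler_pM2l// mulr_gt0// exprn_gt0.
Qed.

Let scE (a b : R) : a *: b = a * b. Proof. by []. Qed.

Lemma is_derive_flat k x :
  is_derive x (1 : R) (flat k) (flat k.+2 x - k%:R * flat k.+1 x).
Proof.
have [x0|x0|->] := ltgtP x 0.
- have -> : flat k.+2 x - k%:R * flat k.+1 x = 0.
    by rewrite /flat ltW// mulr0 subr0.
  apply: (@near_eq_is_derive _ _ _ (cst 0)).
  near=> y; rewrite /flat ltW//; near: y; exact: lt_nbhsl.
- have xn0 : x != 0 by rewrite gt_eqF.
  have dV : is_derive x (1 : R) (fun y : R => y^-1) (- x ^- 2).
    have -> : - x ^- 2 = - (id x) ^- 2 *: 1 by rewrite [_ *: _]mulr1.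
    exact: is_deriveV.
  have dX : is_derive x (1 : R) (fun y : R => y^-1 ^+ k)
      ((k%:R * x^-1 ^+ k.-1) *: (- x ^- 2)).
    rewrite (_ : (fun y => _) = (fun y : R => y^-1) ^+ k).
      exact: (@is_deriveX _ _ (fun y : R => y^-1)).
    by apply/funext => y; rewrite fctE.
  have dE : is_derive x (1 : R) (fun y : R => expR (- y^-1)) (expR (- x^-1) * x ^- 2).
    apply: (@is_derive1_comp _ expR (fun y => - y^-1)).
    by have := is_deriveN dV; rewrite opprK.
  suff D : is_derive x (1 : R) (fun y : R => y^-1 ^+ k * expR (- y^-1))
      (flat k.+2 x - k%:R * flat k.+1 x).
    apply: (near_eq_is_derive _ D); near=> y; rewrite /flat (leNgt y 0).
    suff -> : 0 < y by [].
    by near: y; exact: lt_nbhsr.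
  apply: (is_derive_eq (is_deriveM dX dE)).
  rewrite /flat (leNgt x 0) x0/= -!exprVn !scE.
  case: (k) => [|m]; first by rewrite /= !exprS !expr0; ring.
  rewrite /= !exprS; ring.
- have flat0 j : flat j 0 = 0 by rewrite /flat lexx.
  rewrite !flat0 mulr0 subr0.
  suff H : h^-1 *: (flat k (h *: 1 + 0) - flat k 0) @[h --> (0:R)^'] --> (0:R).
    apply: DeriveDef; first by apply/cvg_ex; exists 0; exact: H.
    by apply/cvg_lim => //; exact: H.
  rewrite flat0.
  have C0 : 0 <= (k.+2)%:R ^+ k.+2 :> R by rewrite exprn_ge0.
  apply/cvgr0Pnorm_le => e e0.
  near=> h.
  have hn0 : h != 0 by near: h; exact: nbhs_dnbhs_neq.
  rewrite subr0 addr0 !scE mulr1.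
  have [h0|h0] := leP h 0; first by rewrite /flat h0 mulr0 normr0 ltW.
  have -> : h^-1 * flat k h = flat k.+1 h.
    by rewrite /flat (leNgt h 0) h0/= exprS mulrA.
  have /andP[f0 fB] := flat_bound k.+1 h0; rewrite ger0_norm//.
  apply: le_trans fB _.
  have hd : `|h| < e / ((k.+2)%:R ^+ k.+2 + 1).
    near: h; apply: dnbhs0_lt; rewrite divr_gt0// ltr_wpDl//.
  rewrite gtr0_norm// ltr_pdivlMr ?ltr_wpDl// in hd.
  apply: le_trans (ltW hd); rewrite mulrC ler_wpM2l ?(ltW h0)//.
  by rewrite lerDl.
Unshelve. all: by end_near. Qed.

Lemma smooth_flat k : smooth (flat k).
Proof.
move=> n; elim: n k => [|n IH] k /=.
  exact: is_derive_continuous (is_derive_flat k).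
exists (fun x => flat k.+2 x - k%:R * flat k.+1 x); first exact: is_derive_flat.
apply: CkD; first exact: IH.
under eq_fun do rewrite -mulNr.
by apply: CkM; [exact: Ck_cst|exact: IH].
Qed.

(** As n grows this tends to the indicator of ]a, b[ and stays between 0 and
    1, which is all that the passages to the limit below require. *)
Definition hump (a b : R) (n : nat) (x : R) : R :=
  flat 0 (n%:R * (x - a)) * flat 0 (n%:R * (b - x)).

Lemma smooth_hump a b n : smooth (hump a b n).
Proof.
move=> m; apply: CkM.
  have := Ck_affine n%:R (- (n%:R * a)) (smooth_flat 0 m).
  by under eq_fun do rewrite -mulrBr.
have := Ck_affine (- n%:R) (n%:R * b) (smooth_flat 0 m).
by under eq_fun do rewrite mulNr addrC -mulrBr.
Qed.

Lemma flat0_itv x : 0 <= flat 0 x <= 1.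
Proof.
rewrite /flat; have [x0|x0] := leP x 0; first by rewrite lexx ler01.
by rewrite expr0 mul1r expR_ge0 -expR0 ler_expR oppr_le0 invr_ge0 ltW.
Qed.

Lemma hump_itv a b n x : 0 <= hump a b n x <= 1.
Proof.
rewrite /hump; have /andP[? ?] := flat0_itv (n%:R * (x - a)).
have /andP[? ?] := flat0_itv (n%:R * (b - x)).
by rewrite mulr_ge0//= mulr_ile1.
Qed.

Lemma hump_out a b n x : ~~ (a < x < b) -> hump a b n x = 0.
Proof.
rewrite negb_and -!leNgt /hump /flat => /orP[xa|bx].
  by rewrite mulr_ge0_le0 ?subr_le0// mul0r.
by rewrite [X in _ * (if X then _ else _)]mulr_ge0_le0 ?subr_le0// mulr0.
Qed.

Lemma cvg_flat0 (c : R) : 0 < c -> flat 0 (n%:R * c) @[n --> \oo] --> (1 : R).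
Proof.
move=> c0.
have H : - (n%:R * c)^-1 @[n --> \oo] --> (0:R).
  rewrite -oppr0; apply: cvgN.
  suff /gtr0_cvgV0 : n%:R * c @[n --> \oo] --> +oo.
    apply; near=> n; rewrite mulr_gt0// ltr0n; near: n; exact: nbhs_infty_gt.
  apply/cvgryPge => A; near=> n; rewrite -ler_pdivrMr//.
  by near: n; exact: nbhs_infty_ger.
have : expR (- (n%:R * c)^-1) @[n --> \oo] --> expR (0 : R).
  by apply: (@continuous_cvg _ _ _ _ _ _ expR); [exact: continuous_expR|exact: H].
rewrite expR0 => E; apply: cvg_trans E; apply: near_eq_cvg; near=> n.
rewrite /flat expr0 mul1r (leNgt _ 0) mulr_gt0// ltr0n; near: n; exact: nbhs_infty_gt.
Unshelve. all: by end_near. Qed.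

Lemma cvg_hump a b x : hump a b n x @[n --> \oo] --> (\1_(`]a, b[%classic) x : R).
Proof.
rewrite indicE; have [xab|/negP xab] := boolP (a < x < b).
  rewrite mem_set/=; last by rewrite in_itv.
  rewrite -(mulr1 1); move/andP: xab => [ax xb].
  by apply: cvgM; apply: cvg_flat0; rewrite subr_gt0.
rewrite memNset/=; last by rewrite in_itv.
rewrite (_ : hump a b ^~ x = cst 0); first exact: cvg_cst.
by apply/funext => n; rewrite hump_out//; apply/negP.
Qed.

End Smooth.

(** * Product test functions *)

Section Product.
Context {R : realType}.

Lemma quotient_ex (f : R * R -> R) (p : R * R) :
  (fun h : R => h^-1 *: (f (h *: ex + p) - f p)) =
  (fun h : R => h^-1 *: (f (h *: (1 : R) + p.1, p.2) - f (p.1, p.2))).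
Proof.
apply/funext => h; rewrite /ex; case: p => x y /=; congr (_ *: (f _ - _)).
by congr (_, _); rewrite /= [_ *: 0]mulr0 add0r.
Qed.

Lemma quotient_ey (f : R * R -> R) (p : R * R) :
  (fun h : R => h^-1 *: (f (h *: ey + p) - f p)) =
  (fun h : R => h^-1 *: (f (p.1, h *: (1 : R) + p.2) - f (p.1, p.2))).
Proof.
apply/funext => h; rewrite /ey; case: p => x y /=; congr (_ *: (f _ - _)).
by congr (_, _); rewrite /= [_ *: 0]mulr0 add0r.
Qed.

Lemma is_derive_exP (f : R * R -> R) (p : R * R) (d : R) :
  is_derive p ex f d <-> is_derive p.1 (1 : R) (fun x => f (x, p.2)) d.
Proof.
have E : 'D_ex f p = 'D_(1 : R) (fun x => f (x, p.2)) p.1.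
  by rewrite /derive quotient_ex.
have D : derivable f p ex = derivable (fun x => f (x, p.2)) p.1 1.
  by rewrite /derivable quotient_ex.
split=> [[df dE]|[df dE]].
  by apply: DeriveDef; [rewrite -D|rewrite -E].
by apply: DeriveDef; [rewrite D|rewrite E].
Qed.

Lemma is_derive_eyP (f : R * R -> R) (p : R * R) (d : R) :
  is_derive p ey f d <-> is_derive p.2 (1 : R) (fun y => f (p.1, y)) d.
Proof.
have E : 'D_ey f p = 'D_(1 : R) (fun y => f (p.1, y)) p.2.
  by rewrite /derive quotient_ey.
have D : derivable f p ey = derivable (fun y => f (p.1, y)) p.2 1.
  by rewrite /derivable quotient_ey.
split=> [[df dE]|[df dE]].
  by apply: DeriveDef; [rewrite -D|rewrite -E].
by apply: DeriveDef; [rewrite D|rewrite E].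
Qed.

Lemma is_derive_tensor_ex (f g df : R -> R) p :
  (forall x, is_derive x (1 : R) f (df x)) ->
  is_derive p ex (fun p : R * R => f p.1 * g p.2) (df p.1 * g p.2).
Proof.
move=> fdf; apply (is_derive_exP _ _ _).2 => /=.
apply: (is_derive_eq (is_deriveM (fdf p.1) (is_derive_cst (g p.2) p.1 (1 : R)))).
by rewrite scaler0 add0r [_ *: _]mulrC.
Qed.

Lemma is_derive_tensor_ey (f g dg : R -> R) p :
  (forall x, is_derive x (1 : R) g (dg x)) ->
  is_derive p ey (fun p : R * R => f p.1 * g p.2) (f p.1 * dg p.2).
Proof.
move=> gdg; apply (is_derive_eyP _ _ _).2 => /=.
apply: (is_derive_eq (is_deriveM (is_derive_cst (f p.1) p.2 (1 : R)) (gdg p.2))).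
by rewrite scaler0 addr0.
Qed.

Lemma Cn_tensor n (f g : R -> R) : Ck n f -> Ck n g ->
  Cn n (fun p : R * R => f p.1 * g p.2).
Proof.
elim: n f g => [|n IH] f g Hf Hg; split=> //; try
  by move=> p; apply: cvgM; (apply: continuous_comp;
    [exact: cvg_fst || exact: cvg_snd|exact: Ck_continuous Hf _ ||
      exact: Ck_continuous Hg _]).
have [Hf' Hg'] := (CkW Hf, CkW Hg).
move: Hf Hg => [df fdf Hdf] [dg gdg Hdg].
have Dx p := is_derive_tensor_ex g p fdf.
have Dy p := is_derive_tensor_ey f p gdg.
split.
- by move=> p; have [] := Dx p.
- by move=> p; have [] := Dy p.
- rewrite (_ : (fun p => _) = (fun p => df p.1 * g p.2)); first exact: IH.
  by apply/funext => p; have [] := Dx p.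
- rewrite (_ : (fun p => _) = (fun p => f p.1 * dg p.2)); first exact: IH.
  by apply/funext => p; have [] := Dy p.
Qed.

Lemma test_function_tensor (O : set (R * R)) (f g : R -> R) (a b c d : R) :
  smooth f -> smooth g ->
  (forall x, x \notin `[a, b] -> f x = 0) ->
  (forall y, y \notin `[c, d] -> g y = 0) ->
  `[a, b] `*` `[c, d] `<=` O ->
  test_function O (fun p : R * R => f p.1 * g p.2).
Proof.
move=> sf sg f0 g0 RO; split; first by move=> n; exact: Cn_tensor.
exists (`[a, b] `*` `[c, d]); split => //.
  by apply: compact_setX; exact: segment_compact.
move=> p /= /not_andP[pab|pcd].
  by rewrite f0 ?mul0r//; apply/negP.
by rewrite g0 ?mulr0//; apply/negP.
Qed.

End Product.

Lemma integrable_indic_lty d (T : measurableType d) (R : realType)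
    (m : {measure set T -> \bar R}) (A : set T) :
  measurable A -> (m A < +oo)%E -> m.-integrable setT (EFin \o \1_A).
Proof.
move=> mA Aoo; apply/integrableP; split.
  by apply/measurable_EFinP; exact: measurable_indic.
under eq_integral do rewrite gee0_abs ?lee_fin//=.
by rewrite integral_indic// setIT.
Qed.

Section Cdf.
Context {R : realType}.
Local Notation mu := (@lebesgue_measure R).
Implicit Types a b x : R.

Lemma measurable_hump a b n : measurable_fun setT (hump a b n).
Proof. exact: continuous_measurable_fun (Ck_continuous (smooth_hump a b n 0)). Qed.

Lemma hump_le_indic a b n x : hump a b n x <= \1_(`]a, b[%classic) x.
Proof.
rewrite indicE; have [xab|xab] := boolP (a < x < b).
  by rewrite mem_set/= ?in_itv//; case/andP: (hump_itv a b n x).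
by rewrite hump_out// memNset//= in_itv/=; exact/negP.
Qed.

Lemma integrable_hump a b n : mu.-integrable setT (EFin \o hump a b n).
Proof.
apply: (@le_integrable _ _ _ _ _ _ _ (EFin \o \1_(`]a, b[%classic :
  set (measurableTypeR R)))) => //.
- by apply/measurable_EFinP; exact: measurable_hump.
- move=> x _ /=; rewrite lee_fin.
  have /andP[b0 _] := hump_itv a b n x.
  rewrite ger0_norm// ger0_norm ?hump_le_indic// indicE; exact: ler0n.
- apply: integrable_indic_lty => //.
  by rewrite /= lebesgue_measure_itv/=; case: ifP => _; rewrite ?ltry// -EFinB ltry.
Qed.

Definition hump_mass a b n : R := \int[mu]_t hump a b n t.
Definition hump_cdf a b n (x : R) : R := \int[mu]_(t in `]-oo, x]) hump a b n t.

Lemma is_derive_hump_cdf a b n x : is_derive x (1 :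
  R) (hump_cdf a b n) (hump a b n x).
Proof.
have xx : x < x + 1 by rewrite ltrDl.
have int : mu.-integrable `]-oo, x + 1] (EFin \o hump a b n).
  exact: integrableS (integrable_hump a b n).
have cx : {for x, continuous (hump a b n)}.
  exact: Ck_continuous (smooth_hump a b n 0) x.
have [dF F'] := continuous_FTC1 xx int (ltNyr x) cx.
by rewrite -F' derive1E; exact: derivableP.
Qed.

Lemma smooth_hump_cdf a b n : smooth (hump_cdf a b n).
Proof.
case=> [|m]; first exact: is_derive_continuous (is_derive_hump_cdf a b n).
exists (hump a b n); [exact: is_derive_hump_cdf|exact: smooth_hump].
Qed.

Lemma hump_cdf_itv a b n x : 0 <= hump_cdf a b n x <= hump_mass a b n.
Proof.
have b0 t : 0 <= hump a b n t by case/andP: (hump_itv a b n t).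
apply/andP; split; first exact: Rintegral_ge0.
rewrite /hump_cdf /hump_mass fine_le//.
- by apply: integrable_fin_num => //; exact: integrableS (integrable_hump a b n).
- by apply: integrable_fin_num => //; exact: integrable_hump.
- apply: ge0_subset_integral => //.
    by apply/measurable_EFinP; exact: measurable_hump.
  by move=> t _; rewrite lee_fin.
Qed.

Lemma hump_cdf_left a b n x : x <= a -> hump_cdf a b n x = 0.
Proof.
move=> xa; rewrite /hump_cdf; under eq_Rintegral => t.
  rewrite inE/= in_itv/= => tx; rewrite hump_out; first over.
  by rewrite negb_and -leNgt (le_trans tx xa).
by rewrite Rintegral_cst// mul0r.
Qed.

Lemma hump_cdf_right a b n x : b <= x -> hump_cdf a b n x = hump_mass a b n.
Proof.
move=> bx; rewrite /hump_cdf /hump_mass Rintegral_mkcond; apply: eq_Rintegral => t _.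
rewrite patchE; case: ifPn => //; rewrite notin_setE/= in_itv/= => /negP.
rewrite -ltNge => xt.
by rewrite hump_out// negb_and -!leNgt (le_trans bx (ltW xt)) orbT.
Qed.

Lemma hump_mass_itv a b n : a <= b -> 0 <= hump_mass a b n <= b - a.
Proof.
move=> ab; have /andP[c0 c1] := hump_cdf_itv a b n 0; rewrite (le_trans c0 c1)/=.
rewrite -lee_fin fineK; last first.
  by apply: integrable_fin_num => //; exact: integrable_hump.
apply: (@le_trans _ _ (\int[mu]_t (\1_(`]a, b[%classic) t)%:E)%E).
  apply: ge0_le_integral => //.
  - by move=> t _; rewrite lee_fin; case/andP: (hump_itv a b n t).
  - by apply/measurable_EFinP; exact: measurable_hump.
  - by apply/measurable_EFinP; exact: measurable_indic.
  - by move=> t _; rewrite lee_fin hump_le_indic.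
rewrite integral_indic// setIT /= lebesgue_measure_itv/=.
by case: ifPn => _; rewrite -?EFinB lee_fin// subr_ge0.
Qed.

Lemma cvg_hump_mass a b : a <= b -> hump_mass a b n @[n --> \oo] --> b - a.
Proof.
move=> ab.
have H : (\int[mu]_t (hump a b n t)%:E)%E @[n --> \oo] -->
    (\int[mu]_t (\1_(`]a, b[%classic) t)%:E)%E.
  apply: (@dominated_cvg _ _ _ mu setT _ (fun n t => (hump a b n t)%:E) (fun t =>
    (\1_(`]a, b[%classic) t)%:E)
    (EFin \o \1_(`]a, b[%classic : set (measurableTypeR R)))) => //.
  - by move=> n; apply/measurable_EFinP; exact: measurable_hump.
  - by move=> t _; apply: cvg_EFin; [near=> n|exact: cvg_hump].
  - apply: integrable_indic_lty => //.
    by rewrite /= lebesgue_measure_itv/=; case: ifP => _; rewrite ?ltry// -EFinB ltry.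
  - move=> n t _; rewrite /= lee_fin.
    by rewrite ger0_norm ?hump_le_indic//; case/andP: (hump_itv a b n t).
rewrite (_ : b - a = fine (\int[mu]_t (\1_(`]a, b[%classic) t)%:E)%E).
  apply: fine_cvg; rewrite fineK//.
  rewrite integral_indic// setIT /= lebesgue_measure_itv/=.
  by case: ifPn.
rewrite integral_indic// setIT /= lebesgue_measure_itv/=.
case: ifPn => //=; rewrite -leNgt lee_fin => ba.
by apply/eqP; rewrite subr_eq0 eq_le ab ba.
Unshelve. all: by end_near. Qed.

(** A primitive of a combination of two humps of total mass 0. Weighting each
    hump by the mass of the other avoids divisions, and total mass 0 makes the
    primitive compactly supported, hence a test profile. *)
Definition wave a b a' b' n (x : R) : R :=
  hump_mass a' b' n * hump_cdf a b n x - hump_mass a b n * hump_cdf a' b' n x.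
Definition dwave a b a' b' n (x : R) : R :=
  hump_mass a' b' n * hump a b n x - hump_mass a b n * hump a' b' n x.

Lemma is_derive_wave a b a' b' n x :
  is_derive x (1 : R) (wave a b a' b' n) (dwave a b a' b' n x).
Proof.
apply: is_deriveB; apply: is_deriveZ; exact: is_derive_hump_cdf.
Qed.

Lemma smooth_wave a b a' b' n : smooth (wave a b a' b' n).
Proof.
move=> m; apply: CkD.
  by apply: CkM; [exact: Ck_cst|exact: smooth_hump_cdf].
under eq_fun do rewrite -mulNr.
by apply: CkM; [exact: Ck_cst|exact: smooth_hump_cdf].
Qed.

Lemma wave_out a b a' b' a0 b0 n x : a0 <= a -> a0 <= a' -> b <= b0 -> b' <= b0 ->
  x \notin `[a0, b0] -> wave a b a' b' n x = 0.
Proof.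
move=> a0a a0a' bb0 b'b0; rewrite in_itv/= negb_and -!ltNge => /orP[x0|x0].
  have xa := le_trans (ltW x0) a0a; have xa' := le_trans (ltW x0) a0a'.
  by rewrite /wave !hump_cdf_left// !mulr0 subr0.
have xb := le_trans bb0 (ltW x0); have xb' := le_trans b'b0 (ltW x0).
by rewrite /wave !hump_cdf_right// mulrC subrr.
Qed.

Lemma norm_cross_le (k m c d A B : R) : 0 <= c <= m -> 0 <= d <= k ->
  m <= A -> k <= B -> `|k * c - m * d| <= A * B.
Proof.
move=> /andP[c0 cm] /andP[d0 dk] mA kB.
have m0 := le_trans c0 cm; have k0 := le_trans d0 dk.
rewrite ler_norml; apply/andP; split.
  rewrite lerNl opprB; apply: le_trans (_ : m * d <= _).
    by rewrite gerBl mulr_ge0.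
  by rewrite ler_pM// (le_trans dk).
apply: le_trans (_ : k * c <= _); first by rewrite gerBl mulr_ge0.
by rewrite mulrC ler_pM// (le_trans cm).
Qed.

(** The bound is uniform in n: it controls the side of the weak identity that
    carries the derivative while the humps sharpen. *)
Lemma wave_le a b a' b' n x : a <= b -> a' <= b' ->
  `|wave a b a' b' n x| <= (b - a) * (b' - a').
Proof.
move=> ab ab'; apply: norm_cross_le; [exact: hump_cdf_itv|exact: hump_cdf_itv| |].
  by case/andP: (hump_mass_itv n ab).
by case/andP: (hump_mass_itv n ab').
Qed.

Lemma dwave_le a b a' b' n x : a <= b -> a' <= b' ->
  `|dwave a b a' b' n x| <= (b' - a') + (b - a).
Proof.
move=> ab ab'; rewrite /dwave; apply: le_trans (ler_normB _ _) _.
have le m h A : 0 <= m <= A -> 0 <= h <= 1 -> `|m * h| <= A :> R.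
  move=> /andP[m0 mA] /andP[h0 h1]; rewrite ger0_norm ?mulr_ge0//.
  by rewrite -[leRHS]mulr1 ler_pM.
by apply: lerD; (apply: le; [exact: hump_mass_itv|exact: hump_itv]).
Qed.

End Cdf.

(** * Mean-zero test profiles in the limit *)

Lemma integrable_mul_bounded d (T : measurableType d) (R : realType)
    (m : {measure set T -> \bar R}) (f k : T -> R) (M : R) :
  m.-integrable setT (EFin \o f) -> measurable_fun setT k ->
  (forall x, `|k x| <= M) ->
  m.-integrable setT (EFin \o (fun x => f x * k x)).
Proof.
move=> intf mk kM.
have mf : measurable_fun setT f by apply/measurable_EFinP; exact: measurable_int intf.
have intMf : m.-integrable setT (fun x => M%:E * (EFin \o f) x)%E.
  exact: integrableZl.
apply: (le_integrable _ _ _ intMf) => //.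
  by apply/measurable_EFinP; exact: measurable_funM.
move=> x _ /=; rewrite lee_fin !normrM mulrC.
by rewrite ler_wpM2r// (le_trans (kM x))// ler_norm.
Qed.

Section Rect.
Context {R : realType}.
Local Notation mu := (@lebesgue_measure R).
Local Notation T2 := (measurableTypeR R * measurableTypeR R)%type.
Local Notation ioo p q := (\1_(`]p, q[%classic : set (measurableTypeR R))).

(** The weak identity for product test functions supported in a box. It is
    stated for functions on the whole plane (zero extensions later on), so
    that it also covers the vertical derivative once the coordinates are
    swapped. *)
Definition rect_ibp (a b c d : R) (U W : T2 -> R) :=
  forall F dF psi : R -> R,
  smooth F -> (forall x, is_derive x (1 : R) F (dF x)) -> smooth psi ->
  (forall x, x \notin `[a, b] -> F x = 0) ->
  (forall y, y \notin `[c, d] -> psi y = 0) ->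
  \int[leb2]_z (U z * (dF z.1 * psi z.2)) =
  - \int[leb2]_z (W z * (F z.1 * psi z.2)).

Lemma measurable_tensor (f g : R -> R) :
  measurable_fun setT f -> measurable_fun setT g ->
  measurable_fun setT (fun z : T2 => f z.1 * g z.2).
Proof.
move=> mf mg; apply: measurable_funM.
  exact: (@measurableT_comp _ _ _ _ _ _ f _ fst).
exact: (@measurableT_comp _ _ _ _ _ _ g _ snd).
Qed.

Lemma indic_itv01 (A : set R) x : 0 <= (\1_A x : R) <= 1.
Proof. by rewrite indicE; case: (_ \in _); rewrite /= ?lexx ?ler01. Qed.

(** Test with a wave in x and a hump in y, and sharpen both. Only the left
    side is passed to the limit, by dominated convergence; on the right the
    primitive is bounded by the product of the two lengths. *)
Lemma rect_limit a b c d (U W : T2 -> R) p q r s :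
  leb2.-integrable setT (EFin \o U) -> leb2.-integrable setT (EFin \o W) ->
  rect_ibp a b c d U W ->
  a <= p -> p < q -> q <= b -> c <= r -> r < s -> s <= d ->
  `|\int[leb2]_z (U z * (((b - a) * ioo p q z.1 - (q - p) * ioo a b z.1)
      * ioo r s z.2))| <=
  (q - p) * (b - a) * \int[leb2]_z (`|W z| * ioo r s z.2).
Proof.
move=> iU iW ibp ap pq qb cr rs sd.
have ab : a <= b by apply: le_trans ap _; apply: le_trans (ltW pq) qb.
have mU : measurable_fun setT U by apply/measurable_EFinP; exact: measurable_int iU.
have mW : measurable_fun setT W by apply/measurable_EFinP; exact: measurable_int iW.
pose M := (b - a) + (q - p).
pose k n (z : T2) := dwave p q a b n z.1 * hump r s n z.2.
pose kl (z : T2) := ((b - a) * ioo p q z.1 - (q - p) * ioo a b z.1) * ioo r s z.2.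
have mk n : measurable_fun setT (k n).
  apply: measurable_tensor; last exact: measurable_hump.
  by apply: measurable_funB; apply: measurable_funM => //; exact: measurable_hump.
have kM n z : `|k n z| <= M.
  rewrite /k normrM -(mulr1 M); have /andP[? ?] := hump_itv r s n z.2.
  by apply: ler_pM => //; [apply: dwave_le => //; exact: ltW|rewrite ger0_norm].
have M0 : 0 <= M by rewrite addr_ge0// subr_ge0// ltW.
have cvgk z : k n z @[n --> \oo] --> kl z.
  apply: cvgM; last exact: cvg_hump.
  apply: cvgB; apply: cvgM; [exact: cvg_hump_mass|exact: cvg_hump| |exact: cvg_hump].
  by apply: cvg_hump_mass; exact: ltW.
have intk n : leb2.-integrable setT (EFin \o (fun z => U z * k n z)).
  exact: integrable_mul_bounded.
have lim : \int[leb2]_z (U z * k n z) @[n --> \oo] --> \int[leb2]_z (U z * kl z).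
  have H : (\int[leb2]_z (U z * k n z)%:E)%E @[n --> \oo] -->
      (\int[leb2]_z (U z * kl z)%:E)%E.
    apply: (@dominated_cvg _ _ _ leb2 setT _ (fun n z => (U z * k n z)%:E)
        (fun z => (U z * kl z)%:E) (fun z => (`|U z| * M)%:E)) => //.
    - by move=> n; exact: measurable_int (intk n).
    - move=> z _; apply: cvg_EFin; first by near=> n.
      by apply: cvgM; [exact: cvg_cst|exact: cvgk].
    - apply: (@integrable_mul_bounded _ _ _ _ (fun z => `|U z|) (fun=> M) M) => //.
        exact: integrable_norm.
      by move=> z; rewrite ger0_norm.
    - by move=> n z _; rewrite abse_EFin lee_fin normrM ler_wpM2l.
  apply: fine_cvg; rewrite fineK//.
  apply: integrable_fin_num => //.
  apply: (@integrable_mul_bounded _ _ _ _ U kl M) => //.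
    apply: (@measurable_tensor (fun x => (b - a) * ioo p q x - (q - p) * ioo a b x)
      (ioo r s)); last exact: measurable_indic.
    by apply: measurable_funB; apply: measurable_funM => //; exact: measurable_indic.
  move=> z.
  have : `|k n z| @[n --> \oo] --> `|kl z| by apply: cvg_norm; exact: cvgk.
  move=> /cvg_lim <- //; apply: limr_le => //.
    by apply/cvg_ex; exists `|kl z|; apply: cvg_norm; exact: cvgk.
  by near=> n.
have bnd n : `|\int[leb2]_z (U z * k n z)| <=
    (q - p) * (b - a) * \int[leb2]_z (`|W z| * ioo r s z.2).
  rewrite (ibp _ _ _ (smooth_wave p q a b n) (is_derive_wave p q a b n)
             (smooth_hump r s n)); last 2 first.
  - by move=> x; exact: wave_out.
  - move=> y; rewrite in_itv/= negb_and -!ltNge => yrs.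
    rewrite hump_out// negb_and -!leNgt.
    by case/orP: yrs => y0; rewrite ?(le_trans (ltW y0) cr)//
      (le_trans sd (ltW y0)) orbT.
  rewrite normrN.
  have iWr : leb2.-integrable setT (EFin \o (fun z => `|W z| * ioo r s z.2)).
    apply: (@integrable_mul_bounded _ _ _ _ (fun z => `|W z|) _ 1).
    - exact: integrable_norm.
    - by apply: (measurableT_comp _ measurable_snd); exact: measurable_indic.
    - by move=> z; have /andP[? ?] := indic_itv01 `]r, s[ z.2; rewrite ger0_norm.
  have wM n' z : `|wave p q a b n' z.1 * hump r s n' z.2| <=
    (q - p) * (b - a) * ioo r s z.2.
    rewrite normrM ler_pM//; first by apply: wave_le => //; exact: ltW.
    by rewrite ger0_norm ?hump_le_indic//; case/andP: (hump_itv r s n' z.2).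
  have iWw : leb2.-integrable setT
      (EFin \o (fun z => W z * (wave p q a b n z.1 * hump r s n z.2))).
    apply: (@integrable_mul_bounded _ _ _ _ _ _ ((q - p) * (b - a))) => //.
      apply: (@measurable_tensor (wave p q a b n) (hump r s n));
        last exact: measurable_hump.
      apply: measurable_realfun.continuous_measurable_fun.
      exact: Ck_continuous (smooth_wave p q a b n 0).
    move=> z; apply: le_trans (wM n z) _; have /andP[? ?] := indic_itv01 `]r, s[ z.2.
    by rewrite ler_piMr// mulr_ge0// subr_ge0// ltW.
  apply: le_trans (le_normr_Rintegral _ iWw) _ => //.
  rewrite -RintegralZl//.
  apply: le_Rintegral => //.
  - exact: (@integrable_norm _ _ _ leb2 setT (fun z =>
      W z * (wave p q a b n z.1 * hump r s n z.2))).
  - exact: (@integrableZl _ _ _ leb2 setT measurableT ((q - p) * (b - a))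
      (EFin \o (fun z => `|W z| * ioo r s z.2))).
  - move=> z _; rewrite normrM [leRHS]mulrCA ler_wpM2l//.
have : `|\int[leb2]_z (U z * k n z)| @[n --> \oo] --> `|\int[leb2]_z (U z * kl z)|.
  exact: cvg_norm.
move=> H; rewrite -/kl -(cvg_lim _ H)//; apply: limr_le => //.
  by apply/cvg_ex; exists `|\int[leb2]_z (U z * kl z)|.
by near=> n; exact: bnd.
Unshelve. all: by end_near. Qed.

End Rect.

(** * Almost everywhere on lines and in the plane *)

Lemma ae_imply d (T : measurableType d) (R : realType)
    (m : {measure set T -> \bar R}) (P Q : T -> Prop) :
  (forall x, P x -> Q x) -> {ae m, forall x, P x} -> {ae m, forall x, Q x}.
Proof. by move=> PQ; apply: filterS. Qed.

Lemma ae_imply2 d (T : measurableType d) (R : realType)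
    (m : {measure set T -> \bar R}) (P Q S : T -> Prop) :
  (forall x, P x -> Q x -> S x) ->
  {ae m, forall x, P x} -> {ae m, forall x, Q x} -> {ae m, forall x, S x}.
Proof. by move=> PQS; apply: filterS2. Qed.

Lemma ae_forall_countable d (T : measurableType d) (R : realType)
    (m : {measure set T -> \bar R}) (I : countType) (P : I -> T -> Prop) :
  (forall i, {ae m, forall x, P i x}) -> {ae m, forall x, forall i, P i x}.
Proof.
move=> aeP.
have : {ae m, forall x, forall n, if unpickle n is Some i then P i x else True}.
  apply: ae_foralln => n; case: (unpickle n) => [i|]; first exact: aeP.
  exact: aeW.
by apply: ae_imply => x H i; have := H (pickle i); rewrite pickleK.
Qed.

Section LebesguePoints.
Context {R : realType}.
Local Notation mu := (@lebesgue_measure R).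

(** The end points are rational so that estimates on averages, each valid for
    almost every slice, can be imposed for countably many intervals at once;
    this family still recovers the value of f at its Lebesgue points. *)
Lemma ae_rat_average (f : R -> R) : mu.-integrable setT (EFin \o f) ->
  {ae mu, forall x, forall c d e, c < x -> x < d -> 0 < e ->
    exists p q : rat, [/\ c < ratr p, ratr p < x, x < ratr q, ratr q < d &
      `|(ratr q - ratr p)^-1 * (\int[mu]_(t in `]ratr p, ratr q[) f t) - f x| < e]}.
Proof.
move=> intf.
have locf : locally_integrable setT f by apply: open_integrable_locally => //;
  exact: openT.
pose h (n : nat) : R := n.+1%:R^-1.
have hpos n : 0 < h n by rewrite invr_gt0 ltr0n.
have H (x : R) (n : nat) : exists pq : rat * rat,
    [/\ x - h n < ratr pq.1, ratr pq.1 < x - (h n) / 2,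
     x + h n / 2 < ratr pq.2 & ratr pq.2 < x + h n].
  have n0 := hpos n.
  have [p /[!in_itv]/= /andP[p1 p2]] : exists q :
    rat, ratr q \in `](x - h n), (x - h n / 2)[%R.
    by apply: rat_in_itvoo; lra.
  have [q /[!in_itv]/= /andP[q1 q2]] : exists q :
    rat, ratr q \in `](x + h n / 2), (x + h n)[%R.
    by apply: rat_in_itvoo; lra.
  by exists (p, q).
pose pq x n := sval (cid (H x n)).
pose E x n : set R := `](ratr (pq x n).1), (ratr (pq x n).2)[%classic.
have muE x n : mu (E x n) = (ratr (pq x n).2 - ratr (pq x n).1)%:E.
  rewrite /E lebesgue_measure_itv/= lte_fin.
  rewrite /pq; case: cid => -[p q] [/= p1 p2 q1 q2].
  have n0 := hpos n.
  by rewrite ifT ?EFinB//; lra.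
(* E x n fills at least half of the ball of radius h n around x. *)
have niceE x : nicely_shrinking x (E x).
  split; first by move=> n; exact: measurable_itv.
  exists (2, fun n => PosNum (hpos n)) => /=; split => //.
  - exact: (@cvg_harmonic R).
  - move=> n y; rewrite /E /pq; case: cid => -[p q] [/= p1 p2 q1 q2].
    rewrite in_itv/= => /andP[py yq]; rewrite /ball/= ltr_norml.
    by apply/andP; split; lra.
  - move=> n; rewrite muE lebesgue_measure_ball; last by rewrite ltW.
    rewrite -EFinM lee_fin /pq; case: cid => -[p q] [/= p1 p2 q1 q2].
    by rewrite mulr2n; lra.
have := lebesgue_differentiation locf.
apply: ae_imply => x xf c d e cx xd e0.
have /= := nice_lebesgue_differentiation niceE locf xf.
have intE n : (\int[mu]_(y in E x n) (f y)%:E = (\int[mu]_(y in E x n) f y)%:E)%E.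
  rewrite fineK//; apply: integrable_fin_num; first exact: measurable_itv.
  by apply: integrableS intf => //; exact: measurable_itv.
have posE n : 0 < ratr (pq x n).2 - ratr (pq x n).1 :> R.
  rewrite subr_gt0 /pq; case: cid => -[p q] [/= p1 p2 q1 q2].
  have n0 := hpos n.
  by lra.
under eq_fun => n do rewrite muE intE inver gt_eqF// -EFinM.
move=> /fine_cvgP[_ /=].
move=> /cvgrPdist_lt /(_ e e0) near_e.
have near_c : \forall n \near \oo, h n < Num.min (x - c) (d - x).
  have [k _ Hk] : \forall n \near \oo, `|h n| < Num.min (x - c) (d - x).
    have /cvgr0Pnorm_lt := @cvg_harmonic R; apply.
    by rewrite lt_min !subr_gt0 cx xd.
  by exists k => // n kn; apply: le_lt_trans (Hk n kn); rewrite ler_norm.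
have [n [Hn1 Hn2]] : exists n, `|f x - (ratr (pq x n).2 - ratr (pq x n).1)^-1 *
     (\int[mu]_(y in E x n) f y)| < e /\ h n < Num.min (x - c) (d - x).
  have [k1 _ h1] := near_e; have [k2 _ h2] := near_c.
  exists (maxn k1 k2); split; first by apply: h1 => /=; exact: leq_maxl.
  by apply: h2 => /=; exact: leq_maxr.
exists (pq x n).1, (pq x n).2.
rewrite distrC in Hn1; move: Hn1; rewrite /E /pq; case: cid =>
  -[p q] [/= p1 p2 q1 q2] ?.
move: Hn2; rewrite lt_min => /andP[h1 h2].
have n0 := hpos n.
by split => //; lra.
Qed.

Lemma ae_ge0_itv (f : R -> R) (c d : R) : mu.-integrable setT (EFin \o f) ->
  (forall r s, c <= r -> r < s -> s <= d -> 0 <= \int[mu]_(t in `]r, s[) f t) ->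
  {ae mu, forall x, c < x < d -> 0 <= f x}.
Proof.
move=> intf H; have := ae_rat_average intf; apply: ae_imply => x Hx /andP[cx xd].
rewrite leNgt; apply/negP => fx0.
have [|p [q [cp px xq qd]]] := Hx _ _ (- f x) cx xd; first by rewrite oppr_gt0.
have pq := lt_trans px xq.
have := H _ _ (ltW cp) pq (ltW qd); set I := Rintegral _ _ _ => I0.
rewrite ltr_norml => /andP[_]; rewrite ltrBlDr addNr ltNge.
by rewrite mulr_ge0// invr_ge0 subr_ge0 ltW.
Qed.

End LebesguePoints.

Section Null.
Context {R : realType}.
Local Notation mu := (@lebesgue_measure R).
Local Notation T2 := (measurableTypeR R * measurableTypeR R)%type.

Lemma measurable_indicE (N : set T2) : measurable N ->
  measurable_fun setT (fun z : T2 => (\1_N z : R)%:E).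
Proof. by move=> mN; apply/measurable_EFinP; exact: measurable_indic. Qed.

Lemma indicE_ge0 (N : set T2) (z : T2) : (0 <= (\1_N z : R)%:E)%E.
Proof. by rewrite lee_fin indicE ler0n. Qed.

Lemma leb2_indic (N : set T2) : measurable N ->
  leb2 N = (\int[leb2]_z (\1_N z : R)%:E)%E.
Proof. by move=> mN; rewrite integral_indic// setIT. Qed.

Lemma ae_section2 (P : T2 -> Prop) : {ae leb2, forall z, P z} ->
  {ae mu, forall y, {ae mu, forall x, P (x, y)}}.
Proof.
move=> [N [mN N0 PN]].
have mI := measurable_indicE mN.
have mG := measurable_fun_fubini_tonelli_G (m1 := mu) _ mI (@indicE_ge0 N).
move: N0; rewrite leb2_indic//.
rewrite (@fubini_tonelli2 _ _ _ _ _ _ _ _ mI (@indicE_ge0 N)) => I0.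
have : ae_eq mu setT (fubini_G mu (fun z : T2 => (\1_N z : R)%:E)) (cst 0%E).
  apply/ae_eq_integral_abs => //; rewrite -[RHS]I0.
  apply: eq_integral => y _; rewrite gee0_abs//.
  by apply: integral_ge0 => x _; exact: indicE_ge0.
apply: ae_imply => y /(_ I) /= Gy0.
have : ae_eq mu setT (fun x => (\1_N (x, y) : R)%:E) (cst 0%E).
  apply/ae_eq_integral_abs => //.
    exact: (measurableT_comp mI (measurable_pair2 y)).
  rewrite -[RHS]Gy0; apply: eq_integral => x _; rewrite gee0_abs//.
apply: ae_imply => x /(_ I) [] /eqP; rewrite indicE pnatr_eq0 eqb0 => xyN.
apply: contrapT => nP; move/negP: xyN; apply; rewrite inE; exact: PN.
Qed.

Lemma ae_section1 (P : T2 -> Prop) : {ae leb2, forall z, P z} ->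
  {ae mu, forall x, {ae mu, forall y, P (x, y)}}.
Proof.
move=> [N [mN N0 PN]].
have mI := measurable_indicE mN.
have mG := measurable_fun_fubini_tonelli_F (m2 := mu) _ mI (@indicE_ge0 N).
move: N0; rewrite leb2_indic//.
rewrite (@fubini_tonelli1 _ _ _ _ _ _ _ _ mI (@indicE_ge0 N)) => I0.
have : ae_eq mu setT (fubini_F mu (fun z : T2 => (\1_N z : R)%:E)) (cst 0%E).
  apply/ae_eq_integral_abs => //; rewrite -[RHS]I0.
  apply: eq_integral => y _; rewrite gee0_abs//.
  by apply: integral_ge0 => x _; exact: indicE_ge0.
apply: ae_imply => x /(_ I) /= Gy0.
have : ae_eq mu setT (fun y => (\1_N (x, y) : R)%:E) (cst 0%E).
  apply/ae_eq_integral_abs => //.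
    exact: (measurableT_comp mI (measurable_pair1 x)).
  rewrite -[RHS]Gy0; apply: eq_integral => y _; rewrite gee0_abs//.
apply: ae_imply => y /(_ I) [] /eqP; rewrite indicE pnatr_eq0 eqb0 => xyN.
apply: contrapT => nP; move/negP: xyN; apply; rewrite inE; exact: PN.
Qed.

(** Measurability of P matters: an arbitrary set with null sections may fail
    to be null. *)
Lemma ae_of_sections (P : set T2) : measurable P ->
  {ae mu, forall y, {ae mu, forall x, P (x, y)}} -> {ae leb2, forall z, P z}.
Proof.
move=> mP H; apply/negligibleP; first exact: measurableC.
change (leb2 (~` P) = 0%E).
have mN : measurable (~` P) by exact: measurableC.
have mI := measurable_indicE mN.
rewrite leb2_indic// (@fubini_tonelli2 _ _ _ _ _ _ _ _ mI (@indicE_ge0 _)).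
rewrite (@ae_eq_integral _ _ _ mu setT (cst 0%E))//; first exact: integral0.
  exact: (measurable_fun_fubini_tonelli_G _ mI (@indicE_ge0 _)).
move: H; apply: ae_imply => y Hy _; rewrite /fubini_G/=.
rewrite (@ae_eq_integral _ _ _ mu setT (cst 0%E))//; first exact: integral0.
  exact: (measurableT_comp mI (measurable_pair2 y)).
move: Hy; apply: ae_imply => x Pxy _ /=.
by rewrite indicE memNset//=; apply.
Qed.

Lemma Rfubini2 (f : T2 -> R) : leb2.-integrable setT (EFin \o f) ->
  mu.-integrable setT (EFin \o (fun y => \int[mu]_x f (x, y))) /\
  \int[leb2]_z f z = \int[mu]_y \int[mu]_x f (x, y).
Proof.
move=> intf.
have mG := measurable_fubini_G intf.
have intG : mu.-integrable setT (fubini_G mu (EFin \o f)).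
  apply/integrableP; split => //.
  have /integrableP[mf foo] := intf.
  apply: le_lt_trans (_ : \int[leb2]_z `|(EFin \o f) z| < +oo)%E => //.
  rewrite fubini_tonelli2//; last exact: measurableT_comp.
  apply: ge0_le_integral => //.
  - exact: measurableT_comp.
  - by apply: measurable_fun_fubini_tonelli_G => //; exact: measurableT_comp.
  - move=> y _; apply: le_abse_integral => //.
    exact: (measurableT_comp mf (measurable_pair2 y)).
have aefin := integrable_ae measurableT intG.
have aeE : ae_eq mu setT (fubini_G mu (EFin \o f))
    (EFin \o (fun y => \int[mu]_x f (x, y))).
  by move: aefin; apply: ae_imply => y /(_ I) /fineK fy _; rewrite /= -fy.
have mG' : measurable_fun setT (EFin \o (fun y => \int[mu]_x f (x, y))).
  apply/measurable_EFinP; rewrite (_ : (fun y => _) =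
    fine \o (fubini_G mu (EFin \o f))) //.
  exact: measurableT_comp.
split.
  apply: (le_integrable measurableT mG' _ intG) => y _.
  rewrite /Rintegral /fubini_G /=.
  by case: (\int[mu]_x _)%E => [u||] //=; rewrite normr0 leey.
rewrite /Rintegral -(integral21_prod_meas1 intf); congr fine.
exact: ae_eq_integral.
Qed.

Lemma leb2_swap (f : T2 -> \bar R) : measurable_fun setT f ->
  (forall z, (0 <= f z)%E) ->
  (\int[leb2]_z f (z.2, z.1) = \int[leb2]_z f z)%E.
Proof.
move=> mf f0.
have mfs : measurable_fun setT (fun z : T2 => f (z.2, z.1)).
  by apply: (measurableT_comp mf); exact: measurable_swap.
by rewrite (@fubini_tonelli2 _ _ _ _ _ _ _ _ mfs)//
  (@fubini_tonelli1 _ _ _ _ _ _ _ _ mf).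
Qed.

Lemma integrable_swap (f : T2 -> R) : leb2.-integrable setT (EFin \o f) ->
  leb2.-integrable setT (EFin \o (fun z => f (z.2, z.1))).
Proof.
move=> /integrableP[mf foo].
apply/integrableP; split.
  by apply: (measurableT_comp mf); exact: measurable_swap.
by rewrite (@leb2_swap (fun z => `|(EFin \o f) z|)%E)//; exact: measurableT_comp.
Qed.

Lemma Rintegral_swap (f : T2 -> R) : measurable_fun setT f ->
  \int[leb2]_z f (z.2, z.1) = \int[leb2]_z f z.
Proof.
move=> /measurable_EFinP mf.
rewrite /Rintegral; congr fine.
rewrite [LHS]integralE [RHS]integralE; congr (_ - _)%E.
  rewrite -(leb2_swap (measurable_funepos mf))//.
  by apply: eq_integral => z _; rewrite !funeposE.
rewrite -(leb2_swap (measurable_funeneg mf))//.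
by apply: eq_integral => z _; rewrite !funenegE.
Qed.

End Null.

(** * Oscillation on almost every segment of a box *)

Section RectAe.
Context {R : realType}.
Local Notation mu := (@lebesgue_measure R).
Local Notation T2 := (measurableTypeR R * measurableTypeR R)%type.
Local Notation ioo p q := (\1_(`]p, q[%classic : set (measurableTypeR R))).

Lemma Rfubini2_strip (f : T2 -> R) r s : leb2.-integrable setT (EFin \o f) ->
  \int[mu]_(y in `]r, s[) \int[mu]_x f (x, y) =
  \int[leb2]_z (f z * ioo r s z.2).
Proof.
move=> intf.
have intfr : leb2.-integrable setT (EFin \o (fun z => f z * ioo r s z.2)).
  apply: (@integrable_mul_bounded _ _ _ _ _ _ 1) => //.
    by apply: (measurableT_comp _ measurable_snd); exact: measurable_indic.
  by move=> z; have /andP[? ?] := indic_itv01 `]r, s[ z.2; rewrite ger0_norm.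
rewrite (Rfubini2 intfr).2 Rintegral_mkcond; apply: eq_Rintegral => y _.
rewrite patchE /=; case: ifPn => yrs.
  by apply: eq_Rintegral => x _; rewrite indicE yrs mulr1.
under eq_Rintegral => x _ do rewrite indicE (negbTE yrs) mulr0.
by rewrite Rintegral_cst// mul0r.
Qed.

(** [rect_limit] for all intervals ]r, s[ of heights compares integrals over
    arbitrary intervals, hence the integrands. *)
Lemma rect_ae_itv a b c d (U W : T2 -> R) p q :
  leb2.-integrable setT (EFin \o U) -> leb2.-integrable setT (EFin \o W) ->
  rect_ibp a b c d U W -> a <= p -> p < q -> q <= b ->
  {ae mu, forall y, c < y < d ->
    `|\int[mu]_x (U (x, y) * ((b - a) * ioo p q x - (q - p) * ioo a b x))| <=
    (q - p) * (b - a) * \int[mu]_x `|W (x, y)|}.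
Proof.
move=> iU iW ibp ap pq qb.
have ab : a < b by apply: le_lt_trans ap _; apply: lt_le_trans pq qb.
pose k x : R := (b - a) * ioo p q x - (q - p) * ioo a b x.
have intUk : leb2.-integrable setT (EFin \o (fun z => U z * k z.1)).
  apply: (@integrable_mul_bounded _ _ _ _ _ _ ((b - a) + (q - p))) => //.
    apply: (@measurableT_comp _ _ _ _ _ _ k _ fst) => //.
    by apply: measurable_funB; apply: measurable_funM => //; exact: measurable_indic.
  move=> z; rewrite /k (le_trans (ler_normB _ _))// !normrM.
  have /andP[? ?] := indic_itv01 `]p, q[ z.1.
  have /andP[? ?] := indic_itv01 `]a, b[ z.1.
  by apply: lerD; rewrite [X in _ * X <= _]ger0_norm// gtr0_norm ?subr_gt0//
    ler_piMr// subr_ge0 ltW.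
have intWn : leb2.-integrable setT (EFin \o (fun z => `|W z|))
  by exact: integrable_norm.
set C := (q - p) * (b - a).
have C0 : 0 <= C by rewrite mulr_ge0// subr_ge0 ltW.
have intQ := (Rfubini2 intUk).1.
have intA := (Rfubini2 intWn).1.
pose Q y := \int[mu]_x (U (x, y) * k x).
pose A y := \int[mu]_x `|W (x, y)|.
have intCA : mu.-integrable setT (EFin \o (fun y => C * A y)).
  exact: (integrableZl _ C intA).
have lim r s : c <= r -> r < s -> s <= d ->
    `|\int[mu]_(y in `]r, s[) Q y| <= \int[mu]_(y in `]r, s[) (C * A y).
  move=> cr rs sd; rewrite RintegralZl//; last first.
    by apply: integrableS intA => //; exact: measurable_itv.
  rewrite (Rfubini2_strip r s intUk) (Rfubini2_strip r s intWn).
  under eq_Rintegral do rewrite -mulrA.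
  exact: (rect_limit iU iW ibp).
have intS r s : mu.-integrable `]r, s[ (EFin \o Q) /\
    mu.-integrable `]r, s[ (EFin \o (fun y => C * A y)).
  by split; [apply: integrableS intQ|apply: integrableS intCA] => //;
    exact: measurable_itv.
have up : {ae mu, forall y, c < y < d -> 0 <= C * A y - Q y}.
  apply: ae_ge0_itv; first exact: (integrableB _ intCA intQ).
  move=> r s cr rs sd; have [i1 i2] := intS r s.
  rewrite RintegralB//.
  by rewrite subr_ge0; exact: le_trans (ler_norm _) (lim _ _ cr rs sd).
have dn : {ae mu, forall y, c < y < d -> 0 <= C * A y + Q y}.
  apply: ae_ge0_itv; first exact: (integrableD _ intCA intQ).
  move=> r s cr rs sd; have [i1 i2] := intS r s.
  rewrite RintegralD//.
  rewrite -lerBlDr sub0r; apply: le_trans (lim _ _ cr rs sd).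
  by rewrite -normrN ler_norm.
apply: (ae_imply2 _ up dn) => y {}up {}dn cyd.
have := up cyd; have := dn cyd => {up} {dn}.
rewrite -/(Q y) -/(A y) ler_norml => h1 h2.
by rewrite lerNl -subr_ge0 opprK h1 -subr_ge0 h2.
Qed.

(** The comparison is with the mean over ]a, b[, rather than between two
    points, because this makes the exceptional set a measurable subset of the
    plane. That is what allows the roles of x and y to be exchanged for
    vertical segments. *)
Lemma rect_ae a b c d (U W : T2 -> R) :
  leb2.-integrable setT (EFin \o U) -> leb2.-integrable setT (EFin \o W) ->
  rect_ibp a b c d U W -> a < b ->
  {ae leb2, forall z, a < z.1 < b -> c < z.2 < d ->
    `|(b - a) * U z - \int[mu]_(x in `]a, b[) U (x, z.2)| <=
    (b - a) * \int[mu]_x `|W (x, z.2)|}.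
Proof.
move=> iU iW ibp ab.
have mU : measurable_fun setT U by apply/measurable_EFinP; exact: measurable_int iU.
have intWn : leb2.-integrable setT (EFin \o (fun z => `|W z|))
  by exact: integrable_norm.
have intUab : leb2.-integrable setT (EFin \o (fun z => U z * ioo a b z.1)).
  apply: (@integrable_mul_bounded _ _ _ _ _ _ 1) => //.
    by apply: (measurableT_comp _ measurable_fst); exact: measurable_indic.
  by move=> z; have /andP[? ?] := indic_itv01 `]a, b[ z.1; rewrite ger0_norm.
have mA : measurable_fun setT (fun y => \int[mu]_x `|W (x, y)|).
  by apply/measurable_EFinP; exact: measurable_int (Rfubini2 intWn).1.
have mB : measurable_fun setT (fun y => \int[mu]_(x in `]a, b[) U (x, y)).
  rewrite (_ : (fun y => _) = (fun y => \int[mu]_x (U (x, y) * ioo a b x))).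
    by apply/measurable_EFinP; exact: measurable_int (Rfubini2 intUab).1.
  apply/funext => y; rewrite Rintegral_mkcond; apply: eq_Rintegral => x _.
  by rewrite patchE indicE; case: ifPn; rewrite ?mulr1 ?mulr0.
pose P := [set z : T2 | a < z.1 < b -> c < z.2 < d ->
    `|(b - a) * U z - \int[mu]_(x in `]a, b[) U (x, z.2)| <=
    (b - a) * \int[mu]_x `|W (x, z.2)|].
suff : {ae leb2, forall z, P z} by [].
apply: ae_of_sections.
  pose D : set T2 := `]a, b[%classic `*` `]c, d[%classic.
  pose h (z : T2) : R := (b - a) * \int[mu]_x `|W (x, z.2)| -
    `|(b - a) * U z - \int[mu]_(x in `]a, b[) U (x, z.2)|.
  have mh : measurable_fun setT h.
    apply: measurable_funB.
      by apply: measurable_funM => //; exact: (measurableT_comp mA measurable_snd).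
    apply: measurableT_comp => //; apply: measurable_funB.
      exact: measurable_funM.
    exact: (measurableT_comp mB measurable_snd).
  have -> : P = ~` D `|` h @^-1` `[0, +oo[%classic.
    apply/seteqP; split=> [z Pz|z].
      have [Dz|] := pselect (D z); last by left.
      right; case: Dz => /=; rewrite !in_itv/= andbT => zab zcd.
      by rewrite subr_ge0; exact: Pz.
    move=> [nD zab zcd|/=]; last by rewrite in_itv/= andbT subr_ge0 => + _ _.
    by exfalso; apply: nD; split; rewrite /= in_itv.
  apply: measurableU.
    by apply: measurableC; apply: measurableX; exact: measurable_itv.
  by rewrite -[X in measurable X]setTI; apply: mh => //; exact: measurable_itv.
have rats : {ae mu, forall y, forall pq : rat * rat,
    a <= ratr pq.1 -> ratr pq.1 < ratr pq.2 :> R -> ratr pq.2 <= b -> c < y < d ->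
    `|\int[mu]_x (U (x, y) * ((b - a) * ioo (ratr pq.1) (ratr pq.2) x -
        (ratr pq.2 - ratr pq.1) * ioo a b x))| <=
    (ratr pq.2 - ratr pq.1) * (b - a) * \int[mu]_x `|W (x, y)|}.
  apply: ae_forall_countable => -[p q] /=.
  have [ap|ap] := leP a (ratr p); last by apply: aeW => y ap'; move: ap;
    rewrite ltNge ap'.
  have [pq|pq] := ltP (ratr p : R) (ratr q); last first.
    by apply: aeW => y _ pq'; move: pq; rewrite leNgt pq'.
  have [qb|qb] := leP (ratr q) b; last first.
    by apply: aeW => y _ _ qb'; move: qb; rewrite ltNge qb'.
  have := rect_ae_itv iU iW ibp ap pq qb; apply: ae_imply => y Hy _ _ _; exact: Hy.
apply: (ae_imply2 _ rats (ae_integrable2 iU)) => y Hy iUy.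
have [cyd|cyd] := boolP (c < y < d); last by apply: aeW => x _ cyd'; move: cyd;
  rewrite cyd'.
have := ae_rat_average (iUy : mu.-integrable setT (EFin \o (fun x => U (x, y)))).
apply: ae_imply => x Hx /= /andP[ax xb] _.
set A := Rintegral _ _ _; set B := Rintegral _ _ _.
have ba0 : 0 < b - a by rewrite subr_gt0.
apply/ler_addgt0Pr => e e0.
have [|p [q [ap px xq qb]]] := Hx a b (e / (b - a)) ax xb; first by rewrite divr_gt0.
have pq := lt_trans px xq; have qp0 : 0 < ratr q - ratr p :> R by rewrite subr_gt0.
set I := Rintegral _ _ _ => Iavg.
have := Hy (p, q) (ltW ap) pq (ltW qb) cyd; rewrite /= -/B.
have iS r s : mu.-integrable setT (EFin \o (fun x => U (x, y) * ioo r s x)).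
  apply: (@integrable_mul_bounded _ _ _ _ (fun x => U (x, y)) _ 1) => //.
  by move=> z; have /andP[? ?] := indic_itv01 `]r, s[ z; rewrite ger0_norm.
have eI r s : \int[mu]_t (U (t, y) * ioo r s t) = \int[mu]_(t in `]r, s[) U (t, y).
  rewrite [RHS]Rintegral_mkcond; apply: eq_Rintegral => t _.
  by rewrite patchE indicE; case: ifPn; rewrite ?mulr1 ?mulr0.
have -> : \int[mu]_x0 (U (x0, y) * ((b - a) * ioo (ratr p) (ratr q) x0 -
    (ratr q - ratr p) * ioo a b x0)) = (b - a) * I - (ratr q - ratr p) * A.
  rewrite /I /A -!eI -RintegralZl// -RintegralZl// -RintegralB//.
  - by apply: eq_Rintegral => t _; ring.
  - exact: (integrableZl _ _ (iS _ _)).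
  - exact: (integrableZl _ _ (iS _ _)).
move=> HI.
have E : (b - a) * U (x, y) - A = (b - a) * (U (x, y) - (ratr q - ratr p)^-1 * I)
    + (ratr q - ratr p)^-1 * ((b - a) * I - (ratr q - ratr p) * A).
  by field; rewrite gt_eqF.
rewrite E (le_trans (ler_normD _ _))// addrC lerD//.
  rewrite normrM [X in X * _]ger0_norm ?invr_ge0 ?(ltW qp0)// ler_pdivrMl//.
  by rewrite mulrA.
by rewrite normrM gtr0_norm// distrC mulrC -ler_pdivlMr// ltW.
Qed.

End RectAe.

(** * From weak derivatives to slices *)

Section Slices.
Context {R : realType}.
Local Notation mu := (@lebesgue_measure R).
Local Notation T2 := (measurableTypeR R * measurableTypeR R)%type.

(** Take s = A / L; when A = 0, a negative value of a is refuted by a small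
    s. *)
Lemma le_sqr_amgm (A L a : R) : 0 <= A -> 0 < L ->
  (forall s, 0 < s -> A <= s * L / 2 + a / (2 * s)) -> A ^+ 2 <= L * a.
Proof.
move=> A0 L0 H; have [A00|An0] := eqVneq A 0.
  rewrite A00 expr0n/= leNgt; apply/negP => La.
  have a0 : a < 0 by rewrite -(pmulr_rlt0 _ L0).
  have := H (Num.sqrt (- a / L) / 2).
  have s0 : 0 < Num.sqrt (- a / L) by rewrite sqrtr_gt0 divr_gt0// oppr_gt0.
  set s := Num.sqrt _ in s0 *; have ss : s ^+ 2 = - a / L.
    by rewrite sqr_sqrtr// divr_ge0 ?oppr_ge0 ?ltW.
  have aE : a = - (L * s ^+ 2) by rewrite ss; field; rewrite gt_eqF.
  move=> /(_ _)/wrap[]; first by rewrite divr_gt0.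
  rewrite aE leNgt => /negP; apply.
  have -> : s / 2 * L / 2 + - (L * s ^+ 2) / (2 * (s / 2)) = - (3 / 4 * (s * L)).
    by field; rewrite gt_eqF.
  by rewrite A00 oppr_lt0 mulr_gt0// mulr_gt0.
have A1 : 0 < A by rewrite lt_def An0.
have := H (A / L); rewrite divr_gt0// => /(_ isT).
rewrite (_ : A / L * L / 2 + a / (2 * (A / L)) = A / 2 + L * a / A / 2); last first.
  by field; rewrite !gt_eqF.
move=> h; have {}h : A <= L * a / A by lra.
by rewrite ler_pdivlMr// in h.
Qed.

(** Cauchy-Schwarz against 1, obtained by integrating |f| <= s / 2 + f^2 / (2
    s) over the segment for every s > 0. *)
Lemma sqr_Rintegral_le (a b : R) (f : R -> R) : a < b ->
  mu.-integrable setT (EFin \o f) -> (forall x, x \notin `[a, b] -> f x = 0) ->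
  (((\int[mu]_x `|f x|) ^+ 2)%:E <= (b - a)%:E * \int[mu]_x ((f x) ^+ 2)%:E)%E.
Proof.
move=> ab intf f0.
have mf : measurable_fun setT f by apply/measurable_EFinP; exact: measurable_int intf.
have I0 : (0 <= \int[mu]_x ((f x) ^+ 2)%:E)%E.
  by apply: integral_ge0 => x _; rewrite lee_fin sqr_ge0.
have [Iy|] := eqVneq (\int[mu]_x ((f x) ^+ 2)%:E)%E (+oo)%E.
  by rewrite Iy gt0_muley ?leey// lte_fin subr_gt0.
rewrite -ltey -ge0_fin_numE// => /fineK; set a2 := fine _ => Ea;
  rewrite -Ea -EFinM lee_fin.
apply: le_sqr_amgm; [exact: Rintegral_ge0|by rewrite subr_gt0|move=> s s0].
rewrite -lee_fin fineK; last first.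
  exact: (integrable_fin_num _ (integrable_norm intf)).
pose g x : R := s / 2 * \1_(`[a, b]%classic : set (measurableTypeR R)) x.
pose k x : R := (2 * s)^-1 * (f x) ^+ 2.
apply: (@le_trans _ _ (\int[mu]_x ((g x)%:E + (k x)%:E))%E).
  apply: ge0_le_integral => //.
  - by apply/measurable_EFinP; exact: measurableT_comp.
  - apply: emeasurable_funD; apply/measurable_EFinP; apply: measurable_funM => //.
    exact: measurable_funX.
  - move=> x _; rewrite -EFinD lee_fin /g /k indicE.
    have [xab|xab] := boolP (x \in `[a, b]); last first.
      rewrite memNset; last exact/negP.
      by rewrite f0// normr0 mulr0 expr0n/= mulr0 addr0.
    rewrite mem_set// mulr1 -subr_ge0 -(@pmulr_rge0 _ (2 * s)) ?mulr_gt0//.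
    rewrite (_ : _ * _ = (s - `|f x|) ^+ 2) ?sqr_ge0//.
    rewrite [RHS]sqrrB real_normK ?num_real//; field; by rewrite gt_eqF.
have g0 x : 0 <= g x by rewrite mulr_ge0 ?divr_ge0 ?indicE ?ler0n// ltW.
have k0 x : 0 <= k x by rewrite mulr_ge0 ?sqr_ge0// invr_ge0 mulr_ge0// ltW.
rewrite ge0_integralD//; last 4 first.
- by move=> x _; rewrite lee_fin.
- by apply/measurable_EFinP; apply: measurable_funM.
- by move=> x _; rewrite lee_fin.
- by apply/measurable_EFinP; apply: measurable_funM => //; exact: measurable_funX.
rewrite EFinD leeD//.
  under eq_integral do rewrite EFinM.
  rewrite ge0_integralZl//; last 2 first.
  - by apply/measurable_EFinP; exact: measurable_indic.
  - by rewrite lee_fin divr_ge0// ltW.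
  rewrite integral_indic// setIT /= lebesgue_measure_itv/= lte_fin ab -EFinB -EFinM lee_fin.
  by rewrite mulrAC.
under eq_integral do rewrite EFinM.
rewrite ge0_integralZl//; last 3 first.
- by apply/measurable_EFinP; exact: measurable_funX.
- by move=> x _; rewrite lee_fin sqr_ge0.
- by rewrite lee_fin invr_ge0 mulr_ge0// ltW.
by rewrite -Ea -EFinM lee_fin mulrC.
Qed.

Lemma is_derive_out (a b : R) (F dF : R -> R) :
  (forall x, is_derive x (1 : R) F (dF x)) ->
  (forall x, x \notin `[a, b] -> F x = 0) -> forall x, x \notin `[a, b] -> dF x = 0.
Proof.
move=> FdF F0 x xab; have [_ <-] := FdF x.
rewrite (@near_eq_derive _ _ _ F (cst 0)) ?derive_cst//.
move: xab; rewrite in_itv/= negb_and -!ltNge => /orP[xa|bx].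
  near=> y; apply: F0; rewrite in_itv/= negb_and -!ltNge; apply/orP; left.
  by near: y; exact: lt_nbhsl.
near=> y; apply: F0; rewrite in_itv/= negb_and -!ltNge; apply/orP; right.
by near: y; exact: lt_nbhsr.
Unshelve. all: by end_near. Qed.

Lemma measurable_deriv (F dF : R -> R) : smooth F ->
  (forall x, is_derive x (1 : R) F (dF x)) -> measurable_fun setT dF.
Proof.
move=> /(_ 2%N) [G FG HG] FdF.
have -> : dF = G by apply/funext => x; have [_ <-] := FdF x; have [_ <-] := FG x.
exact: measurable_realfun.continuous_measurable_fun (@Ck_continuous _ 1 _ HG).
Qed.

Variables (O : set (R * R)) (a b c d : R).
Let Q : set (R * R) := `[a, b] `*` `[c, d].

Lemma measurable_rect : measurable (Q : set T2).
Proof. by apply: measurableX; exact: measurable_itv. Qed.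

Lemma L1loc_rect (f : T2 -> R) : L1loc O f -> Q `<=` O ->
  leb2.-integrable setT (EFin \o (f \_ Q)).
Proof.
move=> [_ intf] QO; rewrite -restrict_EFin.
apply/(integrable_mkcond _ measurable_rect); apply: intf => //.
by apply: compact_setX; exact: segment_compact.
Qed.

Lemma notin_rect (F psi : R -> R) (z : R * R) :
  (forall x, x \notin `[a, b] -> F x = 0) ->
  (forall y, y \notin `[c, d] -> psi y = 0) -> z \notin Q ->
  F z.1 * psi z.2 = 0.
Proof.
move=> F0 psi0 /negP zQ; have [z1|z1] := boolP (z.1 \in `[a, b]); last first.
  by rewrite F0 ?mul0r.
rewrite psi0 ?mulr0//; apply/negP => z2; apply: zQ.
by rewrite inE; split.
Qed.

Lemma patch_rect (f k : R * R -> R) : Q `<=` O -> (forall z, z \notin Q -> k z = 0) ->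
  (fun z => f z * k z) \_ O = (fun z => (f \_ Q) z * k z).
Proof.
move=> QO k0; apply/funext => z; rewrite !patchE.
have [zQ|zQ] := boolP (z \in Q).
  by rewrite ifT//; apply/mem_set/QO/set_mem.
by rewrite k0// !mulr0 if_same.
Qed.

Lemma rect_ibp_ex (u w : R * R -> R) : weak_partial O ex u w -> Q `<=` O ->
  rect_ibp a b c d (u \_ Q) (w \_ Q).
Proof.
move=> [_ _ H] QO F dF psi sF FdF spsi F0 psi0.
have := H _ (test_function_tensor sF spsi F0 psi0 QO).
rewrite Rintegral_mkcond [X in - X]Rintegral_mkcond.
have -> : (fun p : R * R => u p * 'D_ex (fun p => F p.1 * psi p.2) p) =
    (fun p => u p * (dF p.1 * psi p.2)).
  by apply/funext => p; have [_ ->] := is_derive_tensor_ex psi p FdF.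
by rewrite !patch_rect// => z; apply: notin_rect => //; exact: is_derive_out F0.
Qed.

(** The vertical identity is the horizontal one for functions read in the
    other order, because swapping the coordinates preserves the integral. *)
Lemma rect_ibp_ey (u w : R * R -> R) : weak_partial O ey u w -> Q `<=` O ->
  rect_ibp c d a b (fun z => (u \_ Q) (z.2, z.1)) (fun z => (w \_ Q) (z.2, z.1)).
Proof.
move=> [Hu Hw H] QO F dF psi sF FdF spsi F0 psi0.
have := H _ (test_function_tensor spsi sF psi0 F0 QO).
rewrite Rintegral_mkcond [X in - X]Rintegral_mkcond.
have -> : (fun p : R * R => u p * 'D_ey (fun p => psi p.1 * F p.2) p) =
    (fun p => u p * (psi p.1 * dF p.2)).
  by apply/funext => p; have [_ ->] := is_derive_tensor_ey psi p FdF.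
rewrite !patch_rect//; last 2 first.
  by move=> z; exact: notin_rect.
  by move=> z; apply: notin_rect => //; exact: is_derive_out F0.
have mQ (f : T2 -> R) : L1loc O f -> measurable_fun setT (f \_ Q : T2 -> R).
  by move=> /L1loc_rect /(_ QO) Hf; apply/measurable_EFinP; exact: measurable_int Hf.
have mpsi : measurable_fun setT psi.
  exact: measurable_realfun.continuous_measurable_fun (Ck_continuous (spsi 0%N)).
have mF : measurable_fun setT F.
  exact: measurable_realfun.continuous_measurable_fun (Ck_continuous (sF 0%N)).
have mdF := measurable_deriv sF FdF.
rewrite -(@Rintegral_swap _ (fun z => (u \_ Q) z * (psi z.1 * dF z.2))); last first.
  by apply: measurable_funM; [exact: mQ|exact: measurable_tensor].
rewrite -(@Rintegral_swap _ (fun z => (w \_ Q) z * (psi z.1 * F z.2))); last first.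
  by apply: measurable_funM; [exact: mQ|exact: measurable_tensor].
move=> E.
transitivity (\int[leb2]_z ((u \_ Q) (z.2, z.1) * (psi z.2 * dF z.1))).
  by apply: eq_Rintegral => z _; rewrite [psi _ * _]mulrC.
rewrite E; congr (- _).
by apply: eq_Rintegral => z _; rewrite [psi _ * _]mulrC.
Qed.

(** The energy is that of F, a function that dominates f and does not depend
    on the box; this makes the bounds from different boxes comparable. *)
Lemma slice_bound (l r : R) (v f F : R -> R) (x m : R) : l < r ->
  mu.-integrable setT (EFin \o f) -> (forall x, x \notin `[l, r] -> f x = 0) ->
  measurable_fun setT F -> (forall x, `|f x| <= `|F x|) ->
  `|(r - l) * v x - m| <= (r - l) * \int[mu]_x `|f x| ->
  (((v x - (r - l)^-1 * m) ^+ 2)%:E <= (r - l)%:E * \int[mu]_x ((F x) ^+ 2)%:E)%E.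
Proof.
move=> lr intf f0 mF fF H; have rl0 : 0 < r - l by rewrite subr_gt0.
have mf : measurable_fun setT f by apply/measurable_EFinP; exact: measurable_int intf.
apply: (@le_trans _ _ ((\int[mu]_x `|f x|) ^+ 2)%:E).
  rewrite lee_fin -[leLHS]real_normK ?num_real//.
  rewrite lerXn2r ?nnegrE//; first exact: Rintegral_ge0.
  rewrite -(ler_pM2l rl0); apply: le_trans H.
  rewrite -[X in X * _](gtr0_norm rl0) -normrM le_eqVlt; apply/orP; left.
  by apply/eqP; congr `|_|; field; rewrite gt_eqF.
apply: le_trans (sqr_Rintegral_le lr intf f0) _.
rewrite lee_pmul2l ?lte_fin//; apply: ge0_le_integral => //.
- by move=> y _; rewrite lee_fin sqr_ge0.
- by apply/measurable_EFinP; exact: measurable_funX.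
- by apply/measurable_EFinP; exact: measurable_funX.
- move=> y _; rewrite lee_fin -[leLHS]real_normK ?num_real//.
  by rewrite -[leRHS]real_normK ?num_real// lerXn2r ?nnegrE.
Qed.

Lemma slice_ex (u w : R * R -> R) : weak_partial O ex u w -> Q `<=` O ->
  measurable_fun setT (w \_ O : T2 -> R) -> a < b ->
  {ae mu, forall y, c < y < d -> exists m, {ae mu, forall x, a < x < b ->
   (((u (x, y) - m) ^+ 2)%:E <=
    (b - a)%:E * \int[mu]_x (((w \_ O) (x, y)) ^+ 2)%:E)%E}}.
Proof.
move=> wuw QO mw ab; have [Hu Hw _] := wuw.
have iU := L1loc_rect Hu QO; have iW := L1loc_rect Hw QO.
have := ae_section2 (rect_ae iU iW (rect_ibp_ex wuw QO) ab).
move=> H; apply: (ae_imply2 _ H (ae_integrable2 iW)) => {H} y H iWy cyd.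
pose m := \int[mu]_(x in `]a, b[) (u \_ Q) (x, y).
exists ((b - a)^-1 * m); apply: (ae_imply _ H) => x /(_ _ cyd) {}H axb.
have xyQ : (x, y) \in Q.
  move/andP: axb => [ax xb]; move/andP: cyd => [cy yd].
  by rewrite inE; split; rewrite /= in_itv/= ltW//= ltW.
have := H axb; rewrite -/m patchE xyQ => {}H.
apply: (@slice_bound a b (fun x => u (x, y)) (fun x => (w \_ Q) (x, y))) => //.
- move=> t tab; rewrite patchE ifF//; apply/negbTE/negP; rewrite inE => -[/= tab' _].
  by rewrite tab' in tab.
- exact: (measurableT_comp mw (measurable_pair2 y)).
- move=> t; rewrite !patchE; case: ifPn => [tQ|]; last by rewrite normr0.
  by rewrite ifT//; apply/mem_set/QO/set_mem.
Qed.

(** The centre M x does not depend on y, so that two heights can be compared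
    above the same x. *)
Lemma slice_ey (u w : R * R -> R) : weak_partial O ey u w -> Q `<=` O ->
  measurable_fun setT (w \_ O : T2 -> R) -> c < d ->
  exists M : R -> R,
  {ae mu, forall y, c < y < d -> {ae mu, forall x, a < x < b ->
   (((u (x, y) - M x) ^+ 2)%:E <=
    (d - c)%:E * \int[mu]_y (((w \_ O) (x, y)) ^+ 2)%:E)%E}}.
Proof.
move=> wuw QO mw cd; have [Hu Hw _] := wuw.
have iU := L1loc_rect Hu QO; have iW := L1loc_rect Hw QO.
have := ae_section1 (rect_ae (integrable_swap iU) (integrable_swap iW)
  (rect_ibp_ey wuw QO) cd).
pose m x := \int[mu]_(y in `]c, d[) (u \_ Q) (x, y).
move=> H; exists (fun x => (d - c)^-1 * m x).
apply: (ae_imply _ H) => {H} y H cyd.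
apply: (ae_imply2 _ H (ae_integrable1 iW)) => x {}H iWx axb.
have xyQ : (x, y) \in Q.
  move/andP: axb => [ax xb]; move/andP: cyd => [cy yd].
  by rewrite inE; split; rewrite /= in_itv/= ltW//= ltW.
have := H cyd axb; rewrite -/(m x) /= patchE xyQ => {}H.
apply: (@slice_bound c d (fun y => u (x, y)) (fun y => (w \_ Q) (x, y))) => //.
- move=> t tcd; rewrite patchE ifF//; apply/negbTE/negP; rewrite inE => -[/= _ tcd'].
  by rewrite tcd' in tcd.
- exact: (measurableT_comp mw (measurable_pair1 x)).
- move=> t; rewrite !patchE; case: ifPn => [tQ|]; last by rewrite normr0.
  by rewrite ifT//; apply/mem_set/QO/set_mem.
Qed.

End Slices.

(** * A Poincare inequality on stacks of shrinking intervals *)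

Section Domain.
Context {R : realType}.
Local Notation mu := (@lebesgue_measure R).
Local Notation T2 := (measurableTypeR R * measurableTypeR R)%type.

Definition sqr_dist (O : set (R * R)) (u : R * R -> R) (c : R) : \bar R :=
  (\int[leb2]_z ((((fun p => u p - c)%R \_ O) z) ^+ 2)%:E)%E.

(** The slice of [strips lam] at height y is the interval of half-length lam y
    centred at 0. The field [profile_rat] is one-sided continuity of lam in
    |y|, phrased so that closed boxes with rational sides exhaust the
    domain. *)
Record profile (lam : R -> R) : Prop := Profile {
  profile_le1 : forall y, lam y <= 1;
  profile_gt0 : forall y, `|y| < 1 -> 0 < lam y;
  profile_out : forall y, 1 <= `|y| -> lam y <= 0;
  profile_anti : forall y y', `|y| <= `|y'| -> lam y' <= lam y;
  profile_rat : forall y t, 0 < t -> t < lam y ->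
    exists Y : rat, [/\ `|y| < ratr Y, ratr Y <= 1 :> R & t < lam (ratr Y)];
  profile_measurable : measurable_fun setT lam }.

Variable lam : R -> R.
Hypothesis lamP : profile lam.
Let lam_le1 := profile_le1 lamP.
Let lam_gt0 := profile_gt0 lamP.
Let lam_out := profile_out lamP.
Let lam_anti := profile_anti lamP.
Let lam_rat := profile_rat lamP.
Let mlam := profile_measurable lamP.

Definition strips : set (R * R) := [set p | `|p.1| < lam p.2].
Local Notation O := strips.

Lemma strips_bounded p : O p -> `|p.1| < 1 /\ `|p.2| < 1.
Proof.
rewrite /strips/= => H; split; first exact: lt_le_trans H (lam_le1 _).
rewrite ltNge; apply/negP => /lam_out p2.
by have := le_lt_trans (normr_ge0 p.1) (lt_le_trans H p2); rewrite ltxx.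
Qed.

Definition box (t Y : R) : set (R * R) := `[- t, t] `*` `[- Y, Y].

Lemma box_sub (t Y : R) : 0 <= Y -> t < lam Y -> box t Y `<=` O.
Proof.
move=> Y0 tY [x y] [/=]; rewrite !in_itv/= -!ler_norml /strips/= => xt yY.
apply: le_lt_trans xt _; apply: lt_le_trans tY _; apply: lam_anti.
by rewrite [leRHS]ger0_norm.
Qed.

Lemma sqrB_le4 (A B : R) (K : \bar R) : ((A ^+ 2)%:E <= K)%E ->
  ((B ^+ 2)%:E <= K)%E -> (((A - B) ^+ 2)%:E <= 4%:E * K)%E.
Proof.
case: K => [k||]; last by rewrite leeNy_eq.
  rewrite -EFinM !lee_fin => Ak Bk.
  rewrite -subr_ge0 (_ : _ - _ = 2 * (k - A ^+ 2) + 2 * (k - B ^+ 2) + (A + B) ^+ 2).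
    by rewrite addr_ge0 ?sqr_ge0// addr_ge0// mulr_ge0// subr_ge0.
  by ring.
by move=> _ _; rewrite gt0_muley ?lte_fin// leey.
Qed.

Lemma norm_ltE (a x : R) : (- a < x < a) = (`|x| < a).
Proof. by rewrite ltr_norml. Qed.

Section Gradient.
Variables (u : R * R -> R) (G : R * R -> R * R).
Hypothesis wG : weak_gradient O u G.
Local Notation w1 := (((fst \o G) \_ O : T2 -> R)).
Local Notation w2 := (((snd \o G) \_ O : T2 -> R)).
Hypothesis mw1 : measurable_fun setT w1.
Hypothesis mw2 : measurable_fun setT w2.

Definition row_energy y := (\int[mu]_x ((w1 (x, y)) ^+ 2)%:E)%E.
Definition col_energy x := (\int[mu]_y ((w2 (x, y)) ^+ 2)%:E)%E.

Lemma row_energy_ge0 y : (0 <= row_energy y)%E.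
Proof. by apply: integral_ge0 => x _; rewrite lee_fin sqr_ge0. Qed.

Lemma col_energy_ge0 x : (0 <= col_energy x)%E.
Proof. by apply: integral_ge0 => y _; rewrite lee_fin sqr_ge0. Qed.

Definition good_box (tY : rat * rat) :=
  [/\ 0 < ratr tY.1 :> R, 0 < ratr tY.2 :> R, ratr tY.2 <= 1 :> R &
     ratr tY.1 < lam (ratr tY.2) :> R].

(** A full set L, instead of a statement on almost every pair, allows one end
    point to be fixed once and for all. *)
Definition horizontal_good (y : R) := exists L : R -> Prop,
  {ae mu, forall x, L x} /\
  forall x t, L x -> L t -> `|x| < lam y -> `|t| < lam y ->
    (((u (x, y) - u (t, y)) ^+ 2)%:E <= (8 * lam y)%:E * row_energy y)%E.

(** Different boxes give unrelated centres m, so two points are compared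
    within a single box that contains both. *)
Lemma ae_horizontal : {ae mu, forall y, `|y| < 1 -> horizontal_good y}.
Proof.
have : {ae mu, forall y, forall tY : rat * rat, good_box tY -> `|y| < ratr tY.2 ->
    exists m, {ae mu, forall x, `|x| < ratr tY.1 ->
    (((u (x, y) - m) ^+ 2)%:E <= (ratr tY.1 - - ratr tY.1)%:E * row_energy y)%E}}.
  apply: ae_forall_countable => -[t Y].
  have [[/= t0 Y0 Y1 tY]|nB] := pselect (good_box (t, Y)); last exact: aeW.
  have tt : - ratr t < ratr t :> R by rewrite gtrN.
  have := slice_ex wG.1 (box_sub (ltW Y0) tY) mw1 tt.
  apply: ae_imply => y H _ /=; rewrite -norm_ltE => /H[m Hm]; exists m.
  by apply: ae_imply Hm => x Hx; rewrite -norm_ltE; exact: Hx.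
apply: ae_imply => y H y1.
have /choice[m Hm] : forall tY : rat * rat, exists m, good_box tY ->
  `|y| < ratr tY.2 ->
   {ae mu, forall x, `|x| < ratr tY.1 ->
    (((u (x, y) - m) ^+ 2)%:E <= (ratr tY.1 - - ratr tY.1)%:E * row_energy y)%E}.
  move=> tY; have [g|] := pselect (good_box tY); last by exists 0.
  have [yY|yY] := boolP (`|y| < ratr tY.2); last by exists 0.
  by have [m Hm] := H _ g yY; exists m.
exists (fun x => forall tY, good_box tY -> `|y| < ratr tY.2 -> `|x| < ratr tY.1 ->
    (((u (x, y) - m tY) ^+ 2)%:E <= (ratr tY.1 - - ratr tY.1)%:E * row_energy y)%E).
split.
  apply: ae_forall_countable => tY.
  have [g|] := pselect (good_box tY); last by move=> ?; exact: aeW.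
  have [yY|yY] := boolP (`|y| < ratr tY.2); last by apply: aeW.
  by apply: ae_imply (Hm _ g yY).
move=> x t Lx Lt xy ty.
pose s := Num.max `|x| `|t|.
have [q /[!in_itv]/= /andP[sq ql]] : exists q : rat, ratr q \in `]s, (lam y)[%R.
  by apply: rat_in_itvoo; rewrite gt_max xy.
have q0 : 0 < ratr q :> R by apply: le_lt_trans sq; rewrite le_max normr_ge0.
have [Y [yY Y1 qY]] := lam_rat q0 ql.
have g : good_box (q, Y) by split => //=; apply: le_lt_trans yY.
have xq : `|x| < ratr q by apply: le_lt_trans sq; rewrite le_max lexx.
have tq : `|t| < ratr q by apply: le_lt_trans sq; rewrite le_max lexx orbT.
have := sqrB_le4 (Lx _ g yY xq) (Lt _ g yY tq).
rewrite (_ : u (x, y) - m (q, Y) - _ = u (x, y) - u (t, y)); last by ring.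
move=> /le_trans; apply; rewrite /= muleA -EFinM lee_wpmul2r ?row_energy_ge0//
  lee_fin.
by rewrite opprK; lra.
Qed.

Definition vertical_good (M : rat * rat -> R -> R) (y : R) :=
  forall tY : rat * rat, good_box tY -> `|y| < ratr tY.2 ->
    {ae mu, forall x, `|x| < ratr tY.1 ->
    (((u (x, y) - M tY x) ^+ 2)%:E <= (ratr tY.2 - - ratr tY.2)%:E * col_energy x)%E}.

Lemma ae_vertical : exists M, {ae mu, forall y, vertical_good M y}.
Proof.
have /choice[M HM] : forall tY : rat * rat, exists M : R -> R,
    {ae mu, forall y, good_box tY -> `|y| < ratr tY.2 ->
    {ae mu, forall x, `|x| < ratr tY.1 ->
    (((u (x, y) - M x) ^+ 2)%:E <= (ratr tY.2 - - ratr tY.2)%:E * col_energy x)%E}}.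
  move=> [t Y].
  have [[/= t0 Y0 Y1 tY]|nB] := pselect (good_box (t, Y)); last first.
    by exists (fun=> 0); exact: aeW.
  have YY : - ratr Y < ratr Y :> R by rewrite gtrN.
  have [M HM] := slice_ey wG.2 (box_sub (ltW Y0) tY) mw2 YY.
  exists M; apply: ae_imply HM => y H _ /=; rewrite -norm_ltE => /H.
  by apply: ae_imply => x Hx; rewrite -norm_ltE; exact: Hx.
by exists M; apply: ae_forall_countable.
Qed.

Lemma vertical_pair M y y' (t Y : rat) : vertical_good M y -> vertical_good M y' ->
  good_box (t, Y) -> `|y| < ratr Y -> `|y'| < ratr Y ->
  {ae mu, forall x, `|x| < ratr t ->
    (((u (x, y) - u (x, y')) ^+ 2)%:E <= 8%:E * col_energy x)%E}.
Proof.
move=> gy gy' g yY yY'.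
apply: (ae_imply2 _ (gy _ g yY) (gy' _ g yY')) => x Hx Hx' xt.
have := sqrB_le4 (Hx xt) (Hx' xt).
rewrite (_ : u (x, y) - M (t, Y) x - _ = u (x, y) - u (x, y')); last by ring.
move=> /le_trans; apply; rewrite /= muleA -EFinM lee_wpmul2r ?col_energy_ge0//
  lee_fin.
by case: g => /= _ _ Y1 _; rewrite opprK; lra.
Qed.

Lemma measurable_col_energy : measurable_fun setT col_energy.
Proof.
have mf : measurable_fun setT (fun z : T2 => ((w2 z) ^+ 2)%:E).
  by apply/measurable_EFinP; exact: measurable_funX.
apply: (measurable_fun_fubini_tonelli_F _ mf) => z.
by rewrite lee_fin sqr_ge0.
Qed.

Lemma measurable_row_energy : measurable_fun setT row_energy.
Proof.
have mf : measurable_fun setT (fun z : T2 => ((w1 z) ^+ 2)%:E).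
  by apply/measurable_EFinP; exact: measurable_funX.
apply: (measurable_fun_fubini_tonelli_G _ mf) => z.
by rewrite lee_fin sqr_ge0.
Qed.

Lemma ae_exists_itv (P : R -> Prop) (t : R) : 0 < t -> {ae mu, forall x, P x} ->
  exists x, P x /\ `|x| < t.
Proof.
move=> t0 [N [mN N0 PN]]; apply: contrapT => H.
pose I : set (measurableTypeR R) := `](- t), t[%classic.
have sub : I `<=` N.
  move=> x; rewrite /I/= in_itv/= norm_ltE => xt; apply: PN => Px; apply: H.
  by exists x.
have : (mu I <= mu N)%E.
  by apply: le_measure; rewrite ?inE//; exact: measurable_itv.
rewrite N0 /I lebesgue_measure_itv/= lte_fin gtrN// -EFinB lee_fin opprK.
by rewrite leNgt addr_gt0.
Qed.

Lemma sqr_sum3_le (A B C a b c : R) : A ^+ 2 <= a -> B ^+ 2 <= b -> C ^+ 2 <= c ->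
  (A + B + C) ^+ 2 <= 3 * (a + b + c).
Proof.
move=> Aa Bb Cc; rewrite -subr_ge0.
rewrite (_ : _ - _ = 3 * (a - A ^+ 2) + 3 * (b - B ^+ 2) + 3 * (c - C ^+ 2) +
  (A - B) ^+ 2 + (B - C) ^+ 2 + (A - C) ^+ 2); last by ring.
by rewrite !addr_ge0 ?sqr_ge0// mulr_ge0// subr_ge0.
Qed.

(** The path goes from (x, y) to (t, y), then to (t, y'), then to (x', y').
    The two outer pieces are bounded for generic t; the middle one is bounded
    on average over t, whose range has length comparable to the shorter
    slice. *)
Lemma pair_bound M y y' (L L' : R -> Prop) x x' (A A' n2 : R) :
  `|y| < 1 -> `|y'| < 1 -> vertical_good M y -> vertical_good M y' ->
  {ae mu, forall x, L x} -> {ae mu, forall x, L' x} ->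
  (forall x t, L x -> L t -> `|x| < lam y -> `|t| < lam y ->
    (((u (x, y) - u (t, y)) ^+ 2)%:E <= (8 * lam y)%:E * row_energy y)%E) ->
  (forall x t, L' x -> L' t -> `|x| < lam y' -> `|t| < lam y' ->
    (((u (x, y') - u (t, y')) ^+ 2)%:E <= (8 * lam y')%:E * row_energy y')%E) ->
  row_energy y = A%:E -> row_energy y' = A'%:E -> (\int[mu]_t col_energy t =
    n2%:E)%E ->
  L x -> L' x' -> `|x| < lam y -> `|x'| < lam y' ->
  (u (x, y) - u (x', y')) ^+ 2 <=
  24 * lam y * A + 24 * lam y' * A' + 24 * ((lam y)^-1 + (lam y')^-1) * n2.
Proof.
move=> y1 y1' gy gy' aeL aeL' HL HL' EA EA' En2 Lx Lx' xy xy'.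
have ly := lam_gt0 y1; have ly' := lam_gt0 y1'.
have A0 : 0 <= A by have := row_energy_ge0 y; rewrite EA lee_fin.
have A0' : 0 <= A' by have := row_energy_ge0 y'; rewrite EA' lee_fin.
have n20 : 0 <= n2.
  by rewrite -lee_fin -En2; apply: integral_ge0 => t _; exact: col_energy_ge0.
pose l := Num.min (lam y) (lam y').
have l0 : 0 < l by rewrite lt_min ly.
(* Half of the shorter slice costs a factor 2 in the vertical term. *)
have [t /[!in_itv]/= /andP[lt tl]] : exists q : rat, ratr q \in `](l / 2), l[%R.
  by apply: rat_in_itvoo; lra.
have t0 : 0 < ratr t :> R by apply: lt_trans lt; lra.
(* The box reaches slightly above the higher of the two heights. *)
have [Y [yY yY' g]] : exists Y :
  rat, [/\ `|y| < ratr Y, `|y'| < ratr Y & good_box (t, Y)].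
  have [yy|yy] := leP `|y| `|y'|.
    have tl' : ratr t < lam y' by apply: lt_le_trans tl _; rewrite ge_min lexx orbT.
    have [Y [h1 h2 h3]] := lam_rat t0 tl'; exists Y.
    by split => //; [apply: le_lt_trans h1|split => //=; apply: le_lt_trans h1].
  have tl' : ratr t < lam y by apply: lt_le_trans tl _; rewrite ge_min lexx.
  have [Y [h1 h2 h3]] := lam_rat t0 tl'; exists Y.
  by split => //; [apply: lt_trans h1|split => //=; apply: le_lt_trans h1].
set D := (u (x, y) - u (x', y')) ^+ 2.
pose c := 24 * (lam y * A + lam y' * A').
have c0 : 0 <= c by rewrite mulr_ge0// addr_ge0// mulr_ge0// ltW.
have aeD : {ae mu, forall s, `](- ratr t), (ratr t)[%classic s ->
    (D%:E <= c%:E + 24%:E * col_energy s)%E}.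
  have := vertical_pair gy gy' g yY yY'.
  have LL : {ae mu, forall x, L x /\ L' x} by apply: ae_imply2 aeL aeL'.
  apply: ae_imply2 LL => s [Ls Ls'] H.
  rewrite /= in_itv/= norm_ltE => st.
  have sl : `|s| < l by apply: lt_trans st tl.
  move: (sl); rewrite lt_min => /andP[sy sy'].
  have h1 := HL x s Lx Ls xy sy; have h2 := HL' s x' Ls' Lx' sy' xy'.
  have h3 := H st.
  move: h1 h2 h3; rewrite EA EA' -!EFinM !lee_fin => h1 h2.
  have := col_energy_ge0 s; case: (col_energy s) => [e||] //; last first.
    by move=> _ _; rewrite gt0_muley ?lte_fin// addey// leey.
  rewrite lee_fin => e0; rewrite -!EFinM -EFinD !lee_fin => h3.
  rewrite /D (_ : u (x, y) - u (x', y') = (u (x, y) - u (s, y)) +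
    (u (s, y) - u (s, y')) + (u (s, y') - u (x', y'))); last by ring.
  apply: le_trans (sqr_sum3_le h1 h3 h2) _.
  by rewrite le_eqVlt; apply/orP; left; apply/eqP; rewrite /c; ring.
pose I : set (measurableTypeR R) := `](- ratr t), (ratr t)[%classic.
have muI : mu I = (2 * ratr t)%:E.
  rewrite /I lebesgue_measure_itv/= lte_fin gtrN// -EFinB opprK.
  by congr (_%:E); ring.
have mI : measurable I by exact: measurable_itv.
have men2 := measurable_col_energy.
have : (\int[mu]_(s in I) (cst D%:E s) <=
  \int[mu]_(s in I) (c%:E + 24%:E * col_energy s))%E.
  apply: ae_ge0_le_integral => //.
  - by move=> s _; rewrite lee_fin sqr_ge0.
  - by move=> s _; rewrite adde_ge0 ?mule_ge0 ?lee_fin ?col_energy_ge0.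
  - apply: emeasurable_funD => //; apply: emeasurable_funM => //.
    exact: measurable_funS men2.
rewrite integral_cst// (_ : (_ I) = (2 * ratr t)%:E)//.
rewrite ge0_integralD//; last first.
- by apply: emeasurable_funM => //; exact: measurable_funS men2.
- by move=> s _; rewrite mule_ge0 ?col_energy_ge0.
rewrite integral_cst// (_ : (_ I) = (2 * ratr t)%:E)//.
rewrite ge0_integralZl//; last 2 first.
- exact: measurable_funS men2.
- by move=> s _; exact: col_energy_ge0.
have sub : (\int[mu]_(s in I) col_energy s <= n2%:E)%E.
  rewrite -En2; apply: ge0_subset_integral => //.
  by move=> s _; exact: col_energy_ge0.
move=> H.
have {}H : (D%:E * (2 * ratr t)%:E <= c%:E * (2 * ratr t)%:E + 24%:E * n2%:E)%E.
  by apply: le_trans H _; rewrite leeD2l// lee_wpmul2l.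
move: H; rewrite -!EFinM -EFinD lee_fin => H.
have H2 : D <= c + 24 * n2 / (2 * ratr t).
  have t20 : 0 < 2 * ratr t :> R by rewrite mulr_gt0.
  by rewrite -(ler_pM2r t20) [leRHS]mulrDl divfK ?gt_eqF.
have lE : l^-1 <= (lam y)^-1 + (lam y')^-1.
  rewrite /l; case: (ltP (lam y) (lam y')) => _.
    by rewrite lerDl invr_ge0 ltW.
  by rewrite lerDr invr_ge0 ltW.
have t20 : 0 < 2 * ratr t :> R by rewrite mulr_gt0.
have tE : (2 * ratr t : R)^-1 <= (lam y)^-1 + (lam y')^-1 :> R.
  apply: le_trans lE; rewrite lef_pV2 ?posrE//.
  by rewrite -ler_pdivrMl// mulrC ltW.
have nE : 24 * n2 / (2 * ratr t) <= 24 * ((lam y)^-1 + (lam y')^-1) * n2.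
  have gen (p q n : R) : 0 <= n -> p <= q -> 24 * n * p <= 24 * q * n.
    by move=> n0 pq; rewrite mulrAC ler_wpM2r// ler_wpM2l.
  exact: gen n20 tE.
by apply: le_trans H2 _; rewrite /c; apply: lerD => //; rewrite mulrDr !mulrA.
Qed.

Variables n1 n2 : R.
Hypothesis En1 : (\int[leb2]_z ((w1 z) ^+ 2)%:E = n1%:E)%E.
Hypothesis En2 : (\int[leb2]_z ((w2 z) ^+ 2)%:E = n2%:E)%E.

Lemma measurable_strips : measurable (O : set T2).
Proof.
have -> : (O : set T2) = (fun z : T2 => lam z.2 - `|z.1|) @^-1` `]0, +oo[%classic.
  by apply/seteqP; split=> z; rewrite /strips/= in_itv/= andbT subr_gt0.
rewrite -[X in measurable X]setTI.
have mh : measurable_fun setT (fun z : T2 => lam z.2 - `|z.1|).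
  apply: measurable_funB; first exact: (measurableT_comp mlam measurable_snd).
  by apply: measurableT_comp => //; exact: measurable_fst.
by apply: mh => //; exact: measurable_itv.
Qed.

Lemma int_row_energy : (\int[mu]_y row_energy y = n1%:E)%E.
Proof.
have mf : measurable_fun setT (fun z : T2 => ((w1 z) ^+ 2)%:E).
  by apply/measurable_EFinP; exact: measurable_funX.
rewrite -En1 (@fubini_tonelli2 _ _ _ _ _ _ _ _ mf)// => z.
by rewrite lee_fin sqr_ge0.
Qed.

Lemma int_col_energy : (\int[mu]_x col_energy x = n2%:E)%E.
Proof.
have mf : measurable_fun setT (fun z : T2 => ((w2 z) ^+ 2)%:E).
  by apply/measurable_EFinP; exact: measurable_funX.
rewrite -En2 (@fubini_tonelli1 _ _ _ _ _ _ _ _ mf)// => z.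
by rewrite lee_fin sqr_ge0.
Qed.

Lemma n1_ge0 : 0 <= n1.
Proof. by rewrite -lee_fin -int_row_energy; apply: integral_ge0 => y _;
  exact: row_energy_ge0. Qed.

Lemma n2_ge0 : 0 <= n2.
Proof. by rewrite -lee_fin -int_col_energy; apply: integral_ge0 => y _;
  exact: col_energy_ge0. Qed.

Let I1 : set (measurableTypeR R) := `](-1), 1[%classic.

Let mI1 : measurable I1. Proof. exact: measurable_itv. Qed.

Let I1E y : I1 y -> `|y| < 1.
Proof. by rewrite /I1/= in_itv/= norm_ltE. Qed.

Let muI1 : mu I1 = 2%:E.
Proof.
rewrite /I1 lebesgue_measure_itv/= lte_fin gtrN// -EFinB opprK.
by congr (_%:E); ring.
Qed.

Definition area : R := \int[mu]_(y in I1) (2 * lam y).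

Let mlam2 : measurable_fun I1 (fun y => (2 * lam y)%:E).
Proof.
apply/measurable_EFinP; apply: measurable_funM => //.
exact: measurable_funS mlam.
Qed.

Let lam2_ge0 y : I1 y -> (0 <= (2 * lam y)%:E)%E.
Proof. by move=> /I1E y1; rewrite lee_fin mulr_ge0// ltW// lam_gt0. Qed.

Lemma areaE : (\int[mu]_(y in I1) (2 * lam y)%:E = area%:E)%E.
Proof.
rewrite /area /Rintegral fineK// ge0_fin_numE; last exact: integral_ge0.
apply: (@le_lt_trans _ _ (\int[mu]_(y in I1) (cst 2%:E y))%E).
  apply: ge0_le_integral => // y _.
  by rewrite lee_fin /=; have := lam_le1 y; lra.
by rewrite integral_cst// (_ : (_ I1) = 2%:E)// -EFinM ltry.
Qed.

Lemma area_gt0 : 0 < area.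
Proof.
have : 0 <= area by rewrite -lee_fin -areaE; exact: integral_ge0.
rewrite le_eqVlt => /orP[/eqP w0|//]; exfalso.
have : ae_eq mu I1 (fun y => (2 * lam y)%:E) (cst 0%E).
  apply/ae_eq_integral_abs => //; rewrite -[RHS]/(0%:E) w0 -areaE.
  apply: eq_integral => y /set_mem yI; rewrite gee0_abs//; exact: lam2_ge0.
move=> /(ae_exists_itv (@ltr01 R))[y [H y1]].
have : I1 y by rewrite /I1/= in_itv/= norm_ltE.
move=> /H/= /eqP; rewrite eqe => /eqP.
by have := lam_gt0 y1; lra.
Qed.

(** The hypothesis carries the factor 2 lam y, the length of the slice that is
    integrated out; this factor is what absorbs 1 / lam y in [pair_bound]. *)
Lemma sqr_dist_le c (k2 k3 : R) : 0 <= k2 -> 0 <= k3 ->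
  {ae mu, forall y, `|y| < 1 -> {ae mu, forall x, `|x| < lam y ->
    ((2 * lam y * (u (x, y) - c) ^+ 2)%:E <=
      48%:E * row_energy y + (k2 * (2 * lam y))%:E + k3%:E)%E}} ->
  (sqr_dist O u c <= (48 * n1 + k2 * area + k3 * 2)%:E)%E.
Proof.
move=> k20 k30 H.
have [[mu_ _] _ _] := wG.1.
have mg : measurable_fun setT (((fun p => u p - c) \_ O) : T2 -> R).
  apply/(measurable_restrictT _ measurable_strips).
  exact: measurable_funB.
have mf : measurable_fun setT (fun z : T2 => ((((fun p =>
  u p - c)%R \_ O) z) ^+ 2)%:E).
  by apply/measurable_EFinP; exact: measurable_funX.
have f0 z : (0 <= ((((fun p => u p - c)%R \_ O) z) ^+ 2)%:E)%E.
  by rewrite lee_fin sqr_ge0.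
rewrite /sqr_dist (@fubini_tonelli2 _ _ _ _ _ _ _ _ mf f0).
have mF := measurable_fun_fubini_tonelli_G (m1 := mu) _ mf f0.
set F := fubini_G _ _ in mF *.
have F0 y : (0 <= F y)%E by apply: integral_ge0 => x _; exact: f0.
have -> : (\int[mu]_y F y = \int[mu]_(y in I1) F y)%E.
  rewrite [RHS]integral_mkcond; apply: eq_integral => y _.
  rewrite patchE; case: ifPn => // /negP yI.
  have y1 : 1 <= `|y|.
    rewrite leNgt; apply/negP => y1; apply: yI.
    by rewrite inE /I1/= in_itv/= norm_ltE.
  rewrite /F /fubini_G integral0_eq// => x _ /=.
  rewrite patchE ifF ?expr0n//; apply/negbTE/negP; rewrite inE /strips/= => xy.
  have := lam_out y1; have := normr_ge0 x.
  by move=> x0 l0; have := lt_le_trans (le_lt_trans x0 xy) l0; rewrite ltxx.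
apply: (@le_trans _ _ (\int[mu]_(y in I1)
    (48%:E * row_energy y + (k2 * (2 * lam y))%:E + k3%:E))%E).
  have men1 := measurable_funS measurableT (@subsetT _ I1) measurable_row_energy.
  apply: ae_ge0_le_integral => //.
  - exact: measurable_funS mF.
  - move=> y yI; have /I1E y1 := yI; have := lam_gt0 y1.
    by move=> l0; rewrite !adde_ge0 ?mule_ge0 ?row_energy_ge0 ?lee_fin// mulr_ge0//
      mulr_ge0// ltW.
  - apply: emeasurable_funD => //; apply: emeasurable_funD.
      exact: emeasurable_funM.
    apply/measurable_EFinP; apply: measurable_funM => //.
    exact/measurable_EFinP.
  apply: ae_imply H => y Hy yI; have y1 := I1E yI; have l0 := lam_gt0 y1.
  set K := (_ + _ + _)%E.
  have K0 : (0 <= K)%E.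
    by rewrite !adde_ge0 ?mule_ge0 ?row_energy_ge0 ?lee_fin// mulr_ge0// mulr_ge0//
      ltW.
  have [->|Ky] := eqVneq K +oo%E; first by rewrite leey.
  have Kf : K = (fine K)%:E by rewrite fineK// ge0_fin_numE// ltey.
  pose J : set (measurableTypeR R) := `](- lam y), (lam y)[%classic.
  have mJ : measurable J by exact: measurable_itv.
  have l2 : 0 < 2 * lam y by rewrite mulr_gt0.
  have -> : K = (\int[mu]_x ((fine K / (2 * lam y)) * \1_J x)%:E)%E.
    under eq_integral do rewrite EFinM.
    have k0 : 0 <= fine K / (2 * lam y).
      by rewrite divr_ge0 ?(ltW l2)// fine_ge0.
    rewrite ge0_integralZl//; last by apply/measurable_EFinP; exact: measurable_indic.
    rewrite integral_indic// setIT (_ : (_ J) = (2 * lam y)%:E).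
      by rewrite Kf -EFinM divfK// gt_eqF.
    rewrite /J [LHS]lebesgue_measure_itv/= lte_fin gtrN// -EFinB opprK.
    by congr (_%:E); ring.
  apply: ae_ge0_le_integral => //.
  - exact: (measurableT_comp mf (measurable_pair2 y)).
  - move=> x _; rewrite lee_fin mulr_ge0// ?indicE ?ler0n// divr_ge0 ?fine_ge0//.
    exact: ltW.
  - apply/measurable_EFinP; apply: measurable_funM => //; exact: measurable_indic.
  apply: ae_imply (Hy y1) => x Hx _; rewrite lee_fin patchE.
  have [xy|xy] := boolP (`|x| < lam y); last first.
    rewrite ifF ?expr0n/=; last first.
      by apply/negbTE/negP; rewrite inE /strips/=; exact/negP.
    by rewrite mulr_ge0 ?indicE ?ler0n// divr_ge0 ?(ltW l2)// fine_ge0.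
  rewrite ifT; last by rewrite inE.
  rewrite indicE mem_set; last by rewrite /J/= in_itv/= norm_ltE.
  rewrite mulr1 ler_pdivlMr// mulrC -lee_fin -Kf; exact: Hx.
have men1 := measurable_funS measurableT (@subsetT _ I1) measurable_row_energy.
have e0 y : I1 y -> (0 <= 48%:E * row_energy y)%E by move=> _;
  rewrite mule_ge0 ?row_energy_ge0.
have me : measurable_fun I1 (fun y => 48%:E * row_energy y)%E
  by exact: emeasurable_funM.
have l0 y : I1 y -> (0 <= (k2 * (2 * lam y))%:E)%E.
  by move=> yI; have := lam2_ge0 yI; rewrite !lee_fin => ?; rewrite mulr_ge0.
have ml : measurable_fun I1 (fun y => (k2 * (2 * lam y))%:E).
  apply/measurable_EFinP; apply: measurable_funM => //; exact/measurable_EFinP.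
rewrite ge0_integralD//; last 2 first.
- by move=> y yI; rewrite adde_ge0 ?e0 ?l0.
- exact: emeasurable_funD.
rewrite ge0_integralD// integral_cst// (_ : (_ I1) = 2%:E)//
  -EFinM [in leRHS]EFinD leeD2r//.
rewrite [in leRHS]EFinD leeD//.
  rewrite ge0_integralZl//; last by move=> y _; exact: row_energy_ge0.
  rewrite EFinM lee_wpmul2l// -int_row_energy.
  by apply: ge0_subset_integral => //; [exact: measurable_row_energy|move=> y _;
    exact: row_energy_ge0].
under eq_integral do rewrite EFinM.
by rewrite ge0_integralZl// areaE EFinM.
Qed.

(** The infimum is bounded by the estimate attached to any generic y'. This
    estimate contains 1 / lam y', so no single y' gives a uniform constant:
    the inequality is multiplied by 2 lam y' and integrated over y'. *)
Lemma poincare_strips :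
  (ereal_inf [set sqr_dist O u c | c in [set: R]] <= (192 * (n1 + n2))%:E)%E.
Proof.
set m := ereal_inf _.
have [M aeV] := ae_vertical.
have men1 := measurable_row_energy.
have aefin : {ae mu, forall y, row_energy y \is a fin_num}.
  have ien1 : mu.-integrable setT row_energy.
    apply/integrableP; split => //.
    under eq_integral do rewrite gee0_abs ?row_energy_ge0//.
    by rewrite int_row_energy ltry.
  have := integrable_ae measurableT ien1.
  by apply: ae_imply => y /(_ I).
pose good y := [/\ vertical_good M y, `|y| < 1 ->
  horizontal_good y & row_energy y \is a fin_num].
have aeG : {ae mu, forall y, good y}.
  have H1 : {ae mu, forall y, vertical_good M y /\ (`|y| < 1 -> horizontal_good y)}.
    by apply: ae_imply2 aeV ae_horizontal.
  by apply: ae_imply2 H1 aefin => y [h1 h2] h3.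
have w0 := area_gt0; have n10 := n1_ge0; have n20 := n2_ge0.
have key y' : `|y'| < 1 -> good y' ->
    (m <= (48 * n1 + (24 * lam y' * fine (row_energy y') + 24 * n2 / lam y') * area +
      48 * n2 * 2)%:E)%E.
  move=> y1' [gy' hy' fy']; have [L' [aeL' HL']] := hy' y1'.
  have l0' := lam_gt0 y1'.
  have A0' : 0 <= fine (row_energy y') by rewrite fine_ge0// row_energy_ge0.
  have [x' [Lx' xy']] := ae_exists_itv l0' aeL'.
  apply: (@le_trans _ _ (sqr_dist O u (u (x', y')))).
    by apply: ereal_inf_lbound; exists (u (x', y')).
  apply: sqr_dist_le.
  - by rewrite addr_ge0// ?divr_ge0 ?mulr_ge0// ltW.
  - by rewrite mulr_ge0.
  apply: ae_imply aeG => y [gy hy fy] y1; have [L [aeL HL]] := hy y1.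
  apply: (ae_imply _ aeL) => x Lx xy.
  have l0 := lam_gt0 y1; have l1 := lam_le1 y.
  have A0 : 0 <= fine (row_energy y) by rewrite fine_ge0// row_energy_ge0.
  have D := pair_bound y1 y1' gy gy' aeL aeL' HL HL' (esym (fineK fy)) (esym (fineK fy'))
    int_col_energy Lx Lx' xy xy'.
  rewrite -(fineK fy) -EFinM -!EFinD lee_fin.
  have l2 : 0 <= 2 * lam y by rewrite mulr_ge0// ltW.
  apply: le_trans (ler_wpM2l l2 D) _.
  have -> : 2 * lam y * (24 * lam y * fine (row_energy y) + 24 * lam y' * fine (row_energy y') +
      24 * ((lam y)^-1 + (lam y')^-1) * n2) =
        48 * (lam y ^+ 2 * fine (row_energy y)) +
    (24 * lam y' * fine (row_energy y') + 24 * n2 / lam y') * (2 * lam y) + 48 * n2.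
    by field; rewrite !gt_eqF.
  rewrite !lerD2r ler_wpM2l// ler_piMl// expr_le1// ltW//.
have [y0 [gy0 y01]] := ae_exists_itv (@ltr01 R) aeG.
have m0 : (0 <= m)%E.
  apply/ereal_infP => _ [c _ <-]; apply: integral_ge0 => z _.
  by rewrite lee_fin sqr_ge0.
have mfin : m \is a fin_num.
  rewrite ge0_fin_numE//; apply: le_lt_trans (key _ y01 gy0) _; exact: ltry.
pose r := fine m; have mE : m = r%:E by rewrite /r fineK.
have r0 : 0 <= r by rewrite fine_ge0.
rewrite mE lee_fin.
have H : (\int[mu]_(y in I1) (r%:E * (2 * lam y)%:E) <= \int[mu]_(y in I1)
   ((48 * area)%:E * row_energy y + ((48 * n1 + 96 * n2) * (2 * lam y))%:E +
     (48 * n2 * area)%:E))%E.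
  apply: ae_ge0_le_integral => //.
  - by move=> y yI; rewrite mule_ge0 ?lam2_ge0.
  - exact: emeasurable_funM.
  - move=> y yI; have := lam2_ge0 yI; rewrite lee_fin => l0.
    apply: adde_ge0; last by rewrite lee_fin !mulr_ge0// ltW.
    apply: adde_ge0; first by rewrite mule_ge0 ?row_energy_ge0// lee_fin mulr_ge0//
      ltW.
    by rewrite lee_fin mulr_ge0// addr_ge0// mulr_ge0.
  - apply: emeasurable_funD => //; apply: emeasurable_funD.
      by apply: emeasurable_funM => //; exact: measurable_funS men1.
    by apply/measurable_EFinP; apply: measurable_funM => //; exact/measurable_EFinP.
  apply: ae_imply aeG => y gy yI; have y1 := I1E yI.
  have := key y y1 gy; case: gy => _ _ fy; rewrite mE lee_fin => h.
  have l0 := lam_gt0 y1; have l1 := lam_le1 y.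
  have A0 : 0 <= fine (row_energy y) by rewrite fine_ge0// row_energy_ge0.
  rewrite -(fineK fy) -!EFinM -!EFinD lee_fin mulrC.
  have l2 : 0 <= 2 * lam y by rewrite mulr_ge0// ltW.
  apply: le_trans (ler_wpM2l l2 h) _.
  have -> : 2 * lam y * (48 * n1 + (24 * lam y * fine (row_energy y) + 24 * n2 / lam y) * area +
      48 * n2 * 2) = 48 * area * (lam y ^+ 2 * fine (row_energy y)) +
    (48 * n1 + 96 * n2) * (2 * lam y) + 48 * n2 * area.
    by field; rewrite gt_eqF.
  rewrite !lerD2r ler_wpM2l ?mulr_ge0 ?(ltW w0)// ler_piMl// expr_le1// ltW//.
move: H; rewrite ge0_integralZl// areaE -EFinM => H.
have {}H := le_trans H _.
suff : r * area <= 192 * (n1 + n2) * area by rewrite ler_pM2r.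
rewrite -lee_fin; apply: H.
have men1' : measurable_fun I1 row_energy by exact: measurable_funS men1.
have K0 : 0 <= 48 * n1 + 96 * n2 by rewrite addr_ge0// mulr_ge0.
have ml : measurable_fun I1 (fun y => ((48 * n1 + 96 * n2) * (2 * lam y))%:E).
  by apply/measurable_EFinP; apply: measurable_funM => //; exact/measurable_EFinP.
have l0 y : I1 y -> (0 <= ((48 * n1 + 96 * n2) * (2 * lam y))%:E)%E.
  by move=> yI; have := lam2_ge0 yI; rewrite !lee_fin => ?; rewrite mulr_ge0.
have W0 : (0 <= (48 * area)%:E)%E by rewrite lee_fin mulr_ge0// ltW.
have me : measurable_fun I1 (fun y => (48 * area)%:E * row_energy y)%E
  by exact: emeasurable_funM.
have e0 y : I1 y -> (0 <= (48 * area)%:E * row_energy y)%E.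
  by move=> _; rewrite mule_ge0 ?row_energy_ge0.
rewrite ge0_integralD//; last 3 first.
- by move=> y yI; rewrite adde_ge0 ?e0 ?l0.
- exact: emeasurable_funD.
- by move=> y _; rewrite lee_fin !mulr_ge0// ltW.
rewrite ge0_integralD// integral_cst// (_ : (_ I1) = 2%:E)//.
rewrite ge0_integralZl//; last by move=> y _; exact: row_energy_ge0.
under [X in (_ + X + _)%E]eq_integral do rewrite EFinM.
rewrite ge0_integralZl// areaE -!EFinM.
apply: (@le_trans _ _ ((48 * area)%:E * n1%:E +
   ((48 * n1 + 96 * n2) * area)%:E + (48 * n2 * area * 2)%:E)%E).
  rewrite !leeD2r// lee_wpmul2l// -int_row_energy.
  by apply: ge0_subset_integral => // y _; exact: row_energy_ge0.
rewrite -!EFinM -!EFinD lee_fin -subr_ge0.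
rewrite (_ : _ - _ = 96 * (n1 * area)); last by ring.
by rewrite !mulr_ge0// ltW.
Qed.

End Gradient.
End Domain.

(** * The min-max value *)

Section L2.
Context {R : realType}.
Local Notation mu := (@lebesgue_measure R).
Local Notation T2 := (measurableTypeR R * measurableTypeR R)%type.

Lemma L2normE (O : set (R * R)) (f : R * R -> R) :
  L2norm O f = sqrte (\int[leb2]_z (((f \_ O) z) ^+ 2)%:E)%E.
Proof.
rewrite /L2norm unlock poweR12_sqrt; last first.
  by apply: integral_ge0 => z _; exact: poweR_ge0.
congr sqrte; apply: eq_integral => z _ /=.
by rewrite powR_mulrn// real_normK ?num_real.
Qed.

Lemma L2_measurable (O : set (R * R)) (f : R * R -> R) :
  L2 O f -> measurable_fun setT ((f \_ O) : T2 -> R).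
Proof. by rewrite /L2 inE => /andP[]; rewrite inE. Qed.

Lemma L2_integrable (O : set (R * R)) (f : R * R -> R) : L2 O f ->
  leb2.-integrable setT (EFin \o (fun z => ((f \_ O) z) ^+ 2)).
Proof. exact: Lfun2_integrable_sqr. Qed.

Lemma L2_energy (O : set (R * R)) (f : R * R -> R) : L2 O f ->
  (\int[leb2]_z (((f \_ O) z) ^+ 2)%:E =
   (\int[leb2]_z (((f \_ O) z) ^+ 2))%:E)%E.
Proof.
move=> /L2_integrable H; rewrite fineK//.
exact: (integrable_fin_num measurableT H).
Qed.

Lemma dot_sqr (O : set (R * R)) (G : R * R -> R * R) (z : R * R) :
  ((fun p => Num.sqrt (dot (G p) (G p))) \_ O) z ^+ 2 =
  ((fst \o G) \_ O) z ^+ 2 + ((snd \o G) \_ O) z ^+ 2.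
Proof.
rewrite !patchE; case: ifP => _; last by rewrite expr0n/= addr0.
by rewrite sqr_sqrtr /dot/= -?expr2// addr_ge0 ?sqr_ge0.
Qed.

Lemma energy_dot (O : set (R * R)) (G : R * R -> R * R) : L2_field O G ->
  (\int[leb2]_z (((fun p => Num.sqrt (dot (G p) (G p)))%R \_ O) z ^+ 2)%:E =
   (\int[leb2]_z (((fst \o G) \_ O) z ^+ 2) +
    \int[leb2]_z (((snd \o G) \_ O) z ^+ 2))%:E)%E.
Proof.
move=> [G1 G2].
under eq_integral do rewrite dot_sqr EFinD.
rewrite ge0_integralD//.
- by rewrite (L2_energy G1) (L2_energy G2) EFinD.
- by move=> z _; rewrite lee_fin sqr_ge0.
- by apply/measurable_EFinP; apply: measurable_funX; exact: L2_measurable.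
- by move=> z _; rewrite lee_fin sqr_ge0.
- by apply/measurable_EFinP; apply: measurable_funX; exact: L2_measurable.
Qed.

End L2.

Definition sqr_poincare {R : realType} (O : set (R * R)) (K : R) : Prop :=
  forall (u : R * R -> R) (G : R * R -> R * R),
  weak_gradient O u G -> L2_field O G ->
  (ereal_inf [set sqr_dist O u c | c in [set: R]] <=
    (K * (\int[leb2]_z (((fst \o G) \_ O) z ^+ 2) +
          \int[leb2]_z (((snd \o G) \_ O) z ^+ 2)))%:E)%E.

Lemma sqr_poincare_strips (R : realType) (lam : R -> R) :
  profile lam -> sqr_poincare (strips lam) 192.
Proof.
move=> lamP u G wG [G1 G2].
exact: (poincare_strips lamP wG (L2_measurable G1) (L2_measurable G2)
  (L2_energy G1) (L2_energy G2)).
Qed.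

Section MinMax.
Context {R : realType}.
Variables (O : set (R * R)) (K : R).
Hypothesis K0 : 0 < K.
Hypothesis OK : sqr_poincare O K.

Lemma poincare_ineq_sqrt : poincare_ineq O (Num.sqrt K).
Proof.
move=> u G wG LG; rewrite [X in (_ <= _ * X)%E]L2normE energy_dot//.
have := OK wG LG.
set n := (_ + _); move=> Hinf.
have n0 : 0 <= n.
  by rewrite addr_ge0//; apply: Rintegral_ge0 => z _; exact: sqr_ge0.
have Kn0 : 0 <= K * n by rewrite mulr_ge0// ltW.
rewrite /= -EFinM -sqrtrM; last exact: ltW.
apply/lee_addgt0Pr => e e0.
have Ke0 : 0 <= K * n + e ^+ 2 by rewrite addr_ge0 ?sqr_ge0.
(* The infimum may not be attained: spend e^2 on a near minimiser. *)
have /ereal_inf_lt[_ [c _ <-] distc] :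
    (ereal_inf [set sqr_dist O u c | c in [set: R]] < (K * n + e ^+ 2)%:E)%E.
  by apply: le_lt_trans Hinf _; rewrite lte_fin ltrDl exprn_gt0.
apply: ge_ereal_inf; exists (L2norm O (fun p => u p - c)); first by exists c.
rewrite L2normE -/(sqr_dist O u c).
apply: (@le_trans _ _ (sqrte (K * n + e ^+ 2)%:E)).
  by rewrite lee_sqrt; [exact: ltW|rewrite lee_fin].
have s0 : 0 <= Num.sqrt (K * n) by exact: sqrtr_ge0.
rewrite /= -EFinD lee_fin -(@ler_sqr _ (Num.sqrt _)) ?nnegrE ?sqrtr_ge0//; last first.
  by rewrite addr_ge0// ltW.
rewrite sqr_sqrtr// sqrrD sqr_sqrtr// -addrA lerD2l lerDr.
by rewrite mulrn_wge0// mulr_ge0// ltW.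
Qed.

Lemma minmax_ge : (K^-1%:E <= neumann_mu1_minmax O)%E.
Proof.
rewrite /neumann_mu1_minmax.
have s0 : 0 <= Num.sqrt K by exact: sqrtr_ge0.
have le : (poincare_constant O <= (Num.sqrt K)%:E)%E.
  apply: ereal_inf_lbound; exists (Num.sqrt K) => //.
  by split => //; exact: poincare_ineq_sqrt.
have ge : (0 <= poincare_constant O)%E.
  by apply/ereal_infP => _ [B [B0 _] <-]; rewrite lee_fin.
move: le ge; case: (poincare_constant O) => [r||] //; rewrite !lee_fin => le ge.
rewrite -EFin_expe inver; case: eqP => [_|/eqP r0]; first by rewrite leey.
rewrite lee_fin lef_pV2 ?posrE//; last by rewrite lt_def r0 sqr_ge0.
rewrite -[leRHS](@sqr_sqrtr R K); last exact: ltW.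
by rewrite lerXn2r ?nnegrE.
Qed.

End MinMax.

(** * Derivatives of test functions integrate to zero *)

Section Plane.
Context {R : realType}.
Local Notation mu := (@lebesgue_measure R).
Local Notation T2 := (measurableTypeR R * measurableTypeR R)%type.

(** An open set is the union of the rational boxes that it contains. *)
Lemma open_measurable2 (U : set (R * R)) : open U -> measurable (U : set T2).
Proof.
move=> oU.
pose B (q : rat * rat * (rat * rat)) : set T2 :=
  `](ratr q.1.1), (ratr q.1.2)[%classic `*` `](ratr q.2.1), (ratr q.2.2)[%classic.
pose F q : set T2 := if `[< B q `<=` U >] then B q else set0.
have -> : (U : set T2) = \bigcup_q F q.
  apply/seteqP; split=> [[x y] Uxy|z [q _]]; last first.
    by rewrite /F; case: ifPn => // /asboolP; exact.
  have : nbhs (x, y) U by exact: open_nbhs_nbhs.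
  move=> [[V W] /= [/nbhs_ballP[e1 /= e10 xV] /nbhs_ballP[e2 /= e20 yW]] VW].
  have [a /[!in_itv]/= /andP[a1 a2]] : exists q : rat, ratr q \in `](x - e1), x[%R.
    by apply: rat_in_itvoo; rewrite ltrBlDr ltrDl.
  have [b /[!in_itv]/= /andP[b1 b2]] : exists q : rat, ratr q \in `]x, (x + e1)[%R.
    by apply: rat_in_itvoo; rewrite ltrDl.
  have [c /[!in_itv]/= /andP[c1 c2]] : exists q : rat, ratr q \in `](y - e2), y[%R.
    by apply: rat_in_itvoo; rewrite ltrBlDr ltrDl.
  have [d /[!in_itv]/= /andP[d1 d2]] : exists q : rat, ratr q \in `]y, (y + e2)[%R.
    by apply: rat_in_itvoo; rewrite ltrDl.
  exists ((a, b), (c, d)) => //; rewrite /F ifT; last first.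
    apply/asboolP => -[x' y'] [/=]; rewrite !in_itv/= => /andP[xa xb] /andP[yc yd].
    apply: VW; split => /=; [apply: xV|apply: yW]; rewrite /ball/= ltr_norml.
      by apply/andP; split; lra.
    by apply/andP; split; lra.
  by split; rewrite /= in_itv/=; apply/andP.
apply: countable_bigcupT_measurable => // q; rewrite /F; case: ifPn => // _.
by apply: measurableX; exact: measurable_itv.
Qed.

Lemma continuous_measurable2 (f : R * R -> R) : continuous f ->
  measurable_fun setT (f : T2 -> R).
Proof.
move=> cf; apply: (measurability _ (RGenOInfty.measurableE R)) => //.
move=> /= _ [_ [a ->] <-]; rewrite setTI; apply: open_measurable2.
apply: open_comp; first by move=> z _; exact: cf.
exact: interval_open.
Qed.

Lemma Rintegral_slices0 (f : R * R -> R) : continuous f ->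
  (forall p, ~ (`|p.1| < 1 /\ `|p.2| < 1) -> f p = 0) ->
  (forall y, \int[mu]_x f (x, y) = 0) -> \int[leb2]_z f z = 0.
Proof.
move=> cf f0 fy0.
have mf := continuous_measurable2 cf.
pose K : set (R * R) := `[-1, 1] `*` `[-1, 1].
have cK : compact K by apply: compact_setX; exact: segment_compact.
have [M HM] : exists M : R, forall p, K p -> `|f p| <= M.
  have cfK : {within K, continuous f} by apply: continuous_subspaceT; exact: cf.
  have /compact_bounded[M [_ mrt]] := continuous_compact cfK cK.
  by exists (M + 1) => p Kp; apply: mrt; [rewrite ltrDl|exists p].
have intf : leb2.-integrable setT (EFin \o (f : T2 -> R)).
  have mK : measurable (K : set T2) by apply: measurableX; exact: measurable_itv.
  have intK : leb2.-integrable setT (EFin \o (\1_(K : set T2) : T2 -> R)).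
    apply: integrable_indic_lty => //.
    pose J : set (measurableTypeR R) := `[-1, 1]%classic.
    have mJ : measurable J by exact: measurable_itv.
    have -> : leb2 (K : set T2) = (mu J * mu J)%E by exact: product_measure1E.
    by rewrite /J lebesgue_measure_itv/= lte_fin gtrN// -EFinB -EFinM ltry.
  have HM0 : 0 <= M by have := HM (0, 0); move=> /(_ _)/(le_trans _); apply => //;
    split; rewrite /= in_itv/= oppr_le0 ler01.
  apply: (le_integrable _ _ _ (integrableZl measurableT M intK)) => //.
    exact/measurable_EFinP.
  move=> z _ /=; rewrite lee_fin indicE; have [zK|zK] := boolP (z \in (K : set T2)).
    by rewrite mulr1; apply: le_trans (HM _ (set_mem zK)) _; exact: ler_norm.
  rewrite f0 ?normr0 ?normr_ge0// => -[z1 z2]; move/negP: zK; apply; rewrite inE.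
  by split; rewrite /= in_itv/= -ler_norml ltW.
rewrite (Rfubini2 intf).2.
under eq_Rintegral do rewrite fy0.
by rewrite Rintegral_cst// mul0r.
Qed.

Lemma Rintegral_derive0 (F f : R -> R) : (forall x, is_derive x (1 : R) F (f x)) ->
  continuous f -> (forall x, 1 <= `|x| -> f x = 0) -> F 1 = 0 -> F (-1) = 0 ->
  \int[mu]_x f x = 0.
Proof.
move=> Ff cf f0 F1 F1'.
have cF := is_derive_continuous Ff.
pose J : set (measurableTypeR R) := `[-1, 1]%classic.
have H : (\int[mu]_(x in J) (f x)%:E = (F 1)%:E - (F (-1))%:E)%E.
  apply: continuous_FTC2.
  - by rewrite gtrN.
  - by apply: continuous_subspaceT.
  - split.
    + by move=> x _; have [] := Ff x.
    + by apply: cvg_at_right_filter; exact: cF.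
    + by apply: cvg_at_left_filter; exact: cF.
  - by move=> x _; rewrite derive1E; have [_ ->] := Ff x.
rewrite F1 F1' sube0 in H.
suff E : (\int[mu]_x (f x)%:E = \int[mu]_(x in J) (f x)%:E)%E
  by rewrite /Rintegral E H.
rewrite [RHS]integral_mkcond; apply: eq_integral => x _; rewrite patchE.
case: ifPn => // /negP xI; rewrite f0// leNgt; apply/negP => x1; apply: xI.
by rewrite inE/J/= in_itv/= -ler_norml ltW.
Qed.

Variable O : set (R * R).
Hypothesis O1 : forall p, O p -> `|p.1| < 1 /\ `|p.2| < 1.

Lemma test_derive_out (phi : R * R -> R) (K : set (R * R)) (e : R * R) p :
  compact K -> (forall p, ~ K p -> phi p = 0) -> ~ K p -> 'D_e phi p = 0.
Proof.
move=> cK phi0 nKp; rewrite (@near_eq_derive _ _ _ phi (cst 0)) ?derive_cst//.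
have oK : open (~` K).
  by apply: closed_openC; apply: compact_closed => //; exact: norm_hausdorff.
have : nbhs p (~` K) by apply: open_nbhs_nbhs; split.
by apply: filterS => q; exact: phi0.
Qed.

Lemma int_test_ex (phi : R * R -> R) : test_function O phi ->
  \int[leb2]_(p in O) ('D_ex phi p) = 0.
Proof.
move=> [sphi [K [cK KO phi0]]].
have [cphi [dx _ Cx _]] := sphi 1%N.
have cD : continuous (fun p => 'D_ex phi p) := Cx.1.
have D0 p : ~ K p -> 'D_ex phi p = 0 by exact: test_derive_out.
rewrite Rintegral_mkcond (_ : _ \_ O = fun p => 'D_ex phi p); last first.
  apply/funext => p; rewrite patchE; case: ifPn => // /negP pO.
  by rewrite D0// => Kp; apply: pO; rewrite inE; exact: KO.
apply: Rintegral_slices0 => //.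
  by move=> p np; rewrite D0// => Kp; apply: np; exact: O1 (KO _ Kp).
move=> y; apply: (@Rintegral_derive0 (fun x => phi (x, y))).
- move=> x; apply: (is_derive_exP phi (x, y) _).1; exact: derivableP.
- move=> x; apply: (@continuous_comp _ _ _ (fun x => (x, y)) (fun p => 'D_ex phi p)).
    by apply: (@cvg_pair _ _ _ (nbhs x) (nbhs x) (nbhs y) _ _ _ (fun x => x)
      (fun=> y)); [exact: cvg_id|exact: cvg_cst].
  exact: cD.
- by move=> x x1; rewrite D0// => /KO/O1[/= + _]; rewrite ltNge x1.
- by apply: phi0 => /KO/O1[/= + _]; rewrite normr1 ltxx.
- by apply: phi0 => /KO/O1[/= + _]; rewrite normrN1 ltxx.
Qed.

Lemma int_test_ey (phi : R * R -> R) : test_function O phi ->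
  \int[leb2]_(p in O) ('D_ey phi p) = 0.
Proof.
move=> [sphi [K [cK KO phi0]]].
have [cphi [_ dy _ Cy]] := sphi 1%N.
have cD : continuous (fun p => 'D_ey phi p) := Cy.1.
have D0 p : ~ K p -> 'D_ey phi p = 0 by exact: test_derive_out.
rewrite Rintegral_mkcond (_ : _ \_ O = fun p => 'D_ey phi p); last first.
  apply/funext => p; rewrite patchE; case: ifPn => // /negP pO.
  by rewrite D0// => Kp; apply: pO; rewrite inE; exact: KO.
rewrite -(@Rintegral_swap _ (fun p => 'D_ey phi p));
  last exact: continuous_measurable2.
apply: (@Rintegral_slices0 (fun p => 'D_ey phi (p.2, p.1))).
- move=> p; apply: (@continuous_comp _ _ _ (fun p => (p.2, p.1)) (fun p =>
  'D_ey phi p)).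
    exact: swap_continuous.
  exact: cD.
- by move=> p np; rewrite D0// => Kp; apply: np; have [] := O1 (KO _ Kp).
move=> x; apply: (@Rintegral_derive0 (fun y => phi (x, y))).
- move=> y; apply: (is_derive_eyP phi (x, y) _).1; exact: derivableP.
- move=> y; apply: (@continuous_comp _ _ _ (fun y => (x, y)) (fun p => 'D_ey phi p)).
    by apply: (@cvg_pair _ _ _ (nbhs y) (nbhs x) (nbhs y) _ _ _ (fun=> x)
      (fun y => y)); [exact: cvg_cst|exact: cvg_id].
  exact: cD.
- by move=> y y1; rewrite D0// => /KO/O1[/= _]; rewrite ltNge y1.
- by apply: phi0 => /KO/O1[/= _]; rewrite normr1 ltxx.
- by apply: phi0 => /KO/O1[/= _]; rewrite normrN1 ltxx.
Qed.

End Plane.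

(** * Neumann eigenvalues *)

Section Neumann.
Context {R : realType}.
Local Notation mu := (@lebesgue_measure R).
Local Notation T2 := (measurableTypeR R * measurableTypeR R)%type.

Lemma L2I (O : set (R * R)) (f : R * R -> R) :
  measurable_fun setT ((f \_ O) : T2 -> R) ->
  (\int[leb2]_z (((f \_ O) z) ^+ 2)%:E < +oo)%E -> L2 O f.
Proof.
move=> mf foo; rewrite /L2 inE; apply/andP; split; rewrite inE//=.
rewrite /finite_norm -/(L2norm O f) L2normE.
have : (0 <= \int[leb2]_z (((f \_ O) z) ^+ 2)%:E)%E.
  by apply: integral_ge0 => z _; rewrite lee_fin sqr_ge0.
by move: foo; case: (\int[leb2]_z _)%E => [r||] //= _ _; rewrite ltry.
Qed.

Variable O : set (R * R).
Hypothesis O1 : forall p, O p -> `|p.1| < 1 /\ `|p.2| < 1.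
Hypothesis mO : measurable (O : set T2).

Lemma leb2_lty : (leb2 (O : set T2) < +oo)%E.
Proof.
pose J : set (measurableTypeR R) := `[-1, 1]%classic.
have mJ : measurable J by exact: measurable_itv.
have JJ : leb2 (J `*` J) = (mu J * mu J)%E by exact: product_measure1E.
apply: (@le_lt_trans _ _ (leb2 (J `*` J))).
  apply: le_measure; rewrite ?inE//; first exact: measurableX.
  by move=> p /O1[p1 p2]; split; rewrite /J/= in_itv/= -ler_norml ltW.
by rewrite JJ /J lebesgue_measure_itv/= lte_fin gtrN// -EFinB -EFinM ltry.
Qed.

Lemma patch_cst1 : ((fun=> 1 : R) \_ O : T2 -> R) = \1_(O : set T2).
Proof. by apply/funext => z; rewrite patchE indicE; case: ifPn. Qed.

Lemma patch_cst0 : ((fun=> 0 : R) \_ O : T2 -> R) = cst 0.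
Proof. by apply/funext => z; rewrite patchE; case: ifPn. Qed.

Lemma integrable_indicO : leb2.-integrable setT (EFin \o (\1_(O : set T2) : T2 -> R)).
Proof. exact: integrable_indic_lty leb2_lty. Qed.

Lemma L1loc_cst c : L1loc O (fun=> c).
Proof.
split=> [|K cK KO]; first exact: measurable_cst.
have mK : measurable (K : set T2).
  rewrite -(setCK K); apply: measurableC; apply: open_measurable2.
  by apply: closed_openC; apply: compact_closed => //; exact: norm_hausdorff.
apply/integrableP; split; first exact: measurable_cst.
rewrite (@integral_cst _ _ _ leb2 K mK `|c%:E|%E) lte_mul_pinfty//.
apply: le_lt_trans leb2_lty.
by apply: le_measure; rewrite ?inE.
Qed.

(** The weak gradient vanishes because derivatives of test functions have
    integral zero. *)
Lemma W12_cst1 : W12 O (fun=> 1) (fun=> (0, 0)).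
Proof.
have L20 : L2 O (fun=> 0).
  apply: L2I; rewrite patch_cst0; first exact: measurable_cst.
  by under eq_integral do rewrite /= expr0n/=; rewrite integral0 ltry.
have W0 (e : R * R) : (forall phi, test_function O phi ->
    \int[leb2]_(p in O) ('D_e phi p) = 0) ->
    weak_partial O e (fun=> 1) (fun=> 0).
  move=> H; split; [exact: L1loc_cst|exact: L1loc_cst|move=> phi tphi].
  under eq_Rintegral do rewrite mul1r.
  rewrite H//; under [in RHS]eq_Rintegral do rewrite mul0r.
  by rewrite Rintegral_cst// mul0r oppr0.
split; last by split.
- apply: L2I; rewrite patch_cst1; first exact: measurable_indic.
  rewrite (_ : (\int[leb2]_z _ = leb2 (O : set T2))%E) ?leb2_lty//.
  under eq_integral => z _.
    rewrite (_ : \1_O z ^+ 2 = \1_(O : set T2) z); first over.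
    by rewrite indicE; case: (_ \in _); rewrite ?expr0n ?expr1n.
  by rewrite integral_indic// setIT.
- by split; apply: W0 => phi; [exact: int_test_ex|exact: int_test_ey].
Qed.

Variable K : R.
Hypothesis K0 : 0 < K.
Hypothesis OK : sqr_poincare O K.

(** Expand the square: the cross term vanishes, and c^2 times the area of O is
    nonnegative. *)
Lemma mean0_sqr_dist_ge (u : R * R -> R) (c : R) : L2 O u ->
  \int[leb2]_(p in O) u p = 0 ->
  ((\int[leb2]_z ((u \_ O) z ^+ 2))%:E <=
   sqr_dist O u c)%E.
Proof.
move=> L2u u0.
have mf := L2_measurable L2u; have if2 := L2_integrable L2u.
set f := (u \_ O : T2 -> R) in mf if2 *.
have i1 := integrable_indicO.
have iff : leb2.-integrable setT (EFin \o f).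
  apply: (le_integrable _ _ _ (integrableD measurableT i1 if2)) => //.
    exact/measurable_EFinP.
  move=> z _ /=; rewrite lee_fin /f patchE indicE.
  case: ifPn => zO; last by rewrite normr0 normr_ge0.
  rewrite [leRHS]ger0_norm ?addr_ge0 ?sqr_ge0// -subr_ge0.
  rewrite -[u z ^+ 2]real_normK ?num_real//.
  set t := `|u z|; rewrite -[true%:R]/(1 : R).
  have -> : 1 + t ^+ 2 - t = (t - 1 / 2) ^+ 2 + 3 / 4 by field.
  by rewrite addr_ge0 ?sqr_ge0// divr_ge0.
pose k (z : T2) := f z ^+ 2 - (2 * c) * f z.
have ic : leb2.-integrable setT (EFin \o (fun z => (2 * c) * f z)).
  exact: (integrableZl measurableT (2 * c) iff).
have icc : leb2.-integrable setT (EFin \o (fun z => c ^+ 2 * \1_(O : set T2) z)).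
  exact: (integrableZl measurableT (c ^+ 2) i1).
have ik : leb2.-integrable setT (EFin \o k).
  exact: (integrableB measurableT if2 ic).
have Ek : \int[leb2]_z k z = \int[leb2]_z (f z ^+ 2).
  rewrite RintegralB//.
  rewrite RintegralZl// [X in _ - _ * X](_ : _ = 0) ?mulr0 ?subr0//.
  by rewrite -u0 [RHS]Rintegral_mkcond.
have id2 : leb2.-integrable setT (EFin \o (fun z => k z + c ^+ 2 * \1_(O :
  set T2) z)).
  exact: (integrableD measurableT ik icc).
have E z : ((fun p => u p - c) \_ O) z ^+ 2 = k z + c ^+ 2 * \1_(O : set T2) z.
  rewrite /k /f !patchE indicE; case: ifPn => _; first by rewrite /=; ring.
  by rewrite /= expr0n/= !mulr0 subr0 addr0.
rewrite /sqr_dist; under eq_integral do rewrite E.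
rewrite -(fineK (integrable_fin_num measurableT id2)) lee_fin -Ek.
apply: le_Rintegral => // z _.
by rewrite lerDl mulr_ge0 ?sqr_ge0// indicE ler0n.
Qed.

(** Testing with 1 gives mean zero; testing with the eigenfunction itself
    identifies m with its Rayleigh quotient. *)
Lemma neumann_eigenvalue_ge m : neumann_eigenvalue O m -> m != 0 -> K^-1 <= m.
Proof.
move=> [u [G [[L2u wG LG] un0 H]]] m0.
have u0 : \int[leb2]_(p in O) u p = 0.
  have := H _ _ W12_cst1.
  under eq_Rintegral do rewrite /dot/= !mulr0 addr0.
  rewrite Rintegral_cst// mul0r.
  under eq_Rintegral do rewrite mulr1.
  move=> /esym/eqP; rewrite mulf_eq0 (negbTE m0)/= => /eqP; exact.
have HG := H _ _ (And3 L2u wG LG).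
have [G1 G2] := LG.
pose s := \int[leb2]_z ((u \_ O) z ^+ 2).
have sE : \int[leb2]_(p in O) (u p * u p) = s.
  rewrite Rintegral_mkcond /s; apply: eq_Rintegral => z _.
  by rewrite !patchE; case: ifP => _; rewrite ?expr2 ?mulr0.
have nE : \int[leb2]_(p in O) dot (G p) (G p) =
    \int[leb2]_z (((fst \o G) \_ O) z ^+ 2) + \int[leb2]_z (((snd \o G) \_ O) z ^+ 2).
  rewrite Rintegral_mkcond -RintegralD//; last 2 first.
  - exact: L2_integrable.
  - exact: L2_integrable.
  apply: eq_Rintegral => z _; rewrite !patchE; case: ifP => _.
    by rewrite /dot !expr2.
  by rewrite expr0n/= addr0.
rewrite sE nE in HG.
have s0 : 0 <= s by apply: Rintegral_ge0 => z _; exact: sqr_ge0.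
have sn0 : s != 0.
  apply/negP => /eqP s00; apply: un0.
  have mf := L2_measurable L2u.
  have : (\int[leb2]_z `|((u \_ O) z ^+ 2)%:E| = 0)%E.
    under eq_integral do rewrite gee0_abs ?lee_fin ?sqr_ge0//.
    by rewrite (L2_energy L2u) -/s s00.
  have mf2 : measurable_fun setT (fun z : T2 => ((u \_ O) z ^+ 2)%:E).
    by apply/measurable_EFinP; exact: measurable_funX.
  move=> /(ae_eq_integral_abs leb2 measurableT mf2).
  apply: ae_imply => z /(_ I) /= [/eqP]; rewrite sqrf_eq0 patchE => /eqP uz Oz.
  by rewrite -uz ifT// inE.
have sgt0 : 0 < s by rewrite lt_def sn0.
have sle : s <= K * (m * s).
  rewrite -lee_fin -HG; apply: le_trans (OK wG LG).
  by apply/ereal_infP => _ [c _ <-]; exact: mean0_sqr_dist_ge.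
rewrite -(ler_pM2r sgt0) -(ler_pM2l K0) mulrA mulfV ?mul1r//.
by rewrite gt_eqF.
Qed.

Lemma neumann_mu1_ge : (K^-1%:E <= neumann_mu1 O)%E.
Proof.
apply/ereal_infP => _ [m [/= em m0] <-]; rewrite lee_fin.
exact: neumann_eigenvalue_ge.
Qed.

End Neumann.

(** * The Hoelder cusp *)

Section Pi.
Context {R : realType}.

Lemma sin_le_id (x : R) : 0 < x -> sin x <= x.
Proof.
move=> x0.
have [c _ E] : exists2 c : R, c \in `]0, x[%R & sin x - sin 0 = cos c * (x - 0).
  apply: (@MVT _ sin cos) => //.
  by apply: continuous_subspaceT => y; exact: continuous_sin.
move: E; rewrite sin0 !subr0 => ->.
by rewrite ler_piMl ?cos_le1// ltW.
Qed.

(** At pi / 6 the formula for cos (3 x), which vanishes because 3 x = pi / 2,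
    gives cos^2 = 3 sin^2. *)
Lemma sin_pi6 : sin (pi / 6) = 1 / 2 :> R.
Proof.
have pi0 := pi_gt0 R.
have s0 : 0 < sin (pi / 6 : R) by apply: sin_gt0_pihalf; apply/andP; split; lra.
have c0 : 0 < cos (pi / 6 : R) by apply: cos_gt0_pihalf; apply/andP; split; lra.
have E : cos (pi / 2 : R) = 0 := cos_pihalf R.
have E3 : pi / 2 = pi / 6 + (pi / 6 + pi / 6) :> R by field.
move: E; rewrite E3 !cosD sinD.
have := cos2Dsin2 (pi / 6 : R).
set c := cos _ in c0 *; set s := sin _ in s0 * => cs E.
have {}E : c * (c ^+ 2 - 3 * s ^+ 2) = 0 by rewrite -E; ring.
move/eqP: E; rewrite mulf_eq0 gt_eqF//= => /eqP E.
have s2 : s ^+ 2 = (1 / 2) ^+ 2 by lra.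
by move: s2 => /eqP; rewrite eqf_sqr => /orP[/eqP//|/eqP s1]; lra.
Qed.

Lemma pi_ge3 : 3 <= pi :> R.
Proof.
have pi0 := pi_gt0 R.
have := @sin_le_id (pi / 6); rewrite sin_pi6 divr_gt0// => /(_ isT).
by lra.
Qed.

End Pi.

Section Cusp.
Context {R : realType}.
Variable alpha : R.
Hypothesis alpha_gt1 : 1 < alpha.

Let a0 : 0 < alpha. Proof. by apply: lt_trans alpha_gt1. Qed.
Let b0 : 0 < alpha^-1. Proof. by rewrite invr_gt0. Qed.

Definition half_width (y : R) : R := 1 - `|y| `^ alpha^-1.

Lemma powR_inv_alpha (t : R) : 0 <= t -> (t `^ alpha) `^ alpha^-1 = t.
Proof. by move=> t0; rewrite -powRrM mulfV ?gt_eqF// powRr1. Qed.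

Lemma powR_alpha_inv (t : R) : 0 <= t -> (t `^ alpha^-1) `^ alpha = t.
Proof. by move=> t0; rewrite -powRrM mulVf ?gt_eqF// powRr1. Qed.

Lemma half_width_le1 y : half_width y <= 1.
Proof. by rewrite gerBl powR_ge0. Qed.

Lemma half_width_anti y y' : `|y| <= `|y'| -> half_width y' <= half_width y.
Proof. by move=> yy; rewrite lerD2l lerN2 ge0_ler_powR ?nnegrE// ltW. Qed.

Lemma half_width_gt0 y : `|y| < 1 -> 0 < half_width y.
Proof.
move=> y1; rewrite subr_gt0.
have := gt0_ltr_powR b0 (_ : `|y| \in Num.nneg) (_ : 1 \in Num.nneg) y1.
by rewrite powR1; apply; rewrite nnegrE.
Qed.

Lemma half_width_out y : 1 <= `|y| -> half_width y <= 0.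
Proof.
move=> y1; rewrite subr_le0.
have := ge0_ler_powR (ltW b0) (_ : 1 \in Num.nneg) (_ : `|y| \in Num.nneg) y1.
by rewrite powR1; apply; rewrite nnegrE.
Qed.

(** In this form monotonicity of powers does the work of their continuity. *)
Lemma powR_inv_lt (t s : R) : 0 <= t -> 0 <= s -> (t `^ alpha^-1 < s) =
  (t < s `^ alpha).
Proof.
move=> t0 s0; apply/idP/idP => H.
  rewrite -(powR_alpha_inv t0); apply: gt0_ltr_powR => //; rewrite nnegrE//.
  exact: powR_ge0.
rewrite -[ltRHS](powR_inv_alpha s0); apply: gt0_ltr_powR => //; rewrite nnegrE//.
exact: powR_ge0.
Qed.

Lemma half_width_rat y t : 0 < t -> t < half_width y ->
  exists Y : rat, [/\ `|y| < ratr Y, ratr Y <= 1 :> R & t < half_width (ratr Y)].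
Proof.
move=> t0; rewrite /half_width ltrBrDr -ltrBrDl.
have t1 : 0 <= `|y| `^ alpha^-1 by exact: powR_ge0.
move=> H; have s0 : 0 <= 1 - t by apply: le_trans (ltW H).
have [Y /[!in_itv]/= /andP[yY Ys]] : exists q :
  rat, ratr q \in `](`|y|), ((1 - t) `^ alpha)[%R.
  by apply: rat_in_itvoo; rewrite -powR_inv_lt.
have Y0 : 0 <= ratr Y :> R by apply: le_trans (ltW yY).
exists Y; split => //.
  apply: (le_trans (ltW Ys)).
  apply: (@le_trans _ _ (1 `^ alpha)); last by rewrite powR1.
  apply: (ge0_ler_powR (ltW a0)); rewrite ?nnegrE//.
  by rewrite gerBl ltW.
by rewrite (ger0_norm Y0) ltrBrDr -ltrBrDl powR_inv_lt.
Qed.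

Lemma measurable_half_width : measurable_fun setT half_width.
Proof.
apply: measurable_funB; first exact: measurable_cst.
apply: (@measurableT_comp _ _ _ _ _ _ (fun x : R => x `^ alpha^-1) _ (fun x : R =>
  `|x|)).
  exact: measurable_powR.
exact: measurable_realfun.normr_measurable.
Qed.

Lemma half_width_profile : profile half_width.
Proof.
split; [exact: half_width_le1|exact: half_width_gt0|exact: half_width_out|
  exact: half_width_anti|exact: half_width_rat|exact: measurable_half_width].
Qed.

Lemma holder_imageE (x z : R) :
  (holder_map alpha @` rhombus) (x, z) <-> `|x| <= half_width z.
Proof.
rewrite /half_width lerBrDr; split.
  move=> [[x' y] /= H]; rewrite /holder_map/=.
  case: ifPn => [y0|y0] [<- <-].
    rewrite [`|y `^ alpha|]ger0_norm ?powR_ge0// powR_inv_alpha//.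
    by apply: le_trans H; rewrite lerD2l ler_norm.
  by rewrite normrN [`| `|y| `^ alpha|]ger0_norm ?powR_ge0// powR_inv_alpha.
move=> H; have w0 : 0 <= `|z| `^ alpha^-1 by exact: powR_ge0.
have [z0|z0] := leP 0 z.
  exists (x, `|z| `^ alpha^-1); first by rewrite /rhombus/= (ger0_norm w0).
  by rewrite /holder_map/= w0 powR_alpha_inv// ger0_norm.
have wgt0 : 0 < `|z| `^ alpha^-1 by rewrite powR_gt0 ?normr_gt0 ?lt_eqF.
exists (x, - `|z| `^ alpha^-1); first by rewrite /rhombus/= normrN (ger0_norm w0).
rewrite /holder_map/= oppr_ge0 leNgt wgt0/= normrN (ger0_norm w0) powR_alpha_inv//.
by rewrite ltr0_norm ?opprK.
Qed.

(** A point of the image with |x| = half_width z leaves it when |x| increases,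
    so it is not interior. Conversely, the strict inequality persists on a box
    around the point: separate |z|^(1/alpha) and 1 - |x| by some s and use
    [powR_inv_lt]. *)
Lemma holder_cuspE : holder_cusp alpha = strips half_width.
Proof.
apply/seteqP; split=> [[x z]|[x z]].
  rewrite /holder_cusp/interior/= => -[[V W] /= [/nbhs_ballP[e /= e0 xV] zW] VW].
  rewrite /strips/=.
  (* Moving x away from 0 keeps the point in the image. *)
  pose d := if 0 <= x then e / 2 else - (e / 2).
  have dE : `|x + d| = `|x| + e / 2.
    rewrite /d; case: (leP 0 x) => x0.
      by rewrite !ger0_norm ?addr_ge0// ?divr_ge0// ltW.
    by rewrite ltr0_norm ?(ltr0_norm x0); lra.
  have : (holder_map alpha @` rhombus) (x + d, z).
    apply: VW; split => /=; last exact: nbhs_singleton.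
    apply: xV; rewrite /ball/= opprD addrA subrr add0r normrN.
    have -> : `|d| = e / 2 by rewrite /d; case: ifP;
      rewrite ?normrN gtr0_norm ?divr_gt0.
    by lra.
  by rewrite holder_imageE dE => H; lra.
rewrite /strips/= => xz; rewrite /holder_cusp/interior/=.
have [s sz xs] : exists2 s, `|z| `^ alpha^-1 < s & `|x| < 1 - s.
  move: xz; rewrite /half_width => xz.
  exists ((`|z| `^ alpha^-1 + (1 - `|x|)) / 2); lra.
have s0 : 0 <= s by apply: le_trans (ltW sz); exact: powR_ge0.
rewrite powR_inv_lt// in sz.
exists ([set x' | `|x'| < 1 - s], [set z' | `|z'| < s `^ alpha]) => /=.
  split; apply: open_nbhs_nbhs; split => //=.
    have -> : [set x' : R | `|x'| < 1 - s] = ball (0 : R) (1 - s).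
      by apply/seteqP; split=> y /=; rewrite /ball/= sub0r normrN.
    by apply: ball_open; apply: le_lt_trans xs.
  have -> : [set x' : R | `|x'| < s `^ alpha] = ball (0 : R) (s `^ alpha).
    by apply/seteqP; split=> y /=; rewrite /ball/= sub0r normrN.
  by apply: ball_open; apply: le_lt_trans sz.
move=> [x' z'] /= [x's z's]; apply/holder_imageE.
by rewrite /half_width; rewrite -powR_inv_lt// in z's; lra.
Qed.

End Cusp.

Unset Implicit Arguments.

Theorem theorem5p1 (R : realType) (alpha : R) (alpha_gt1 : 1 < alpha)
    (mu1 : \bar R)
    (mu1E : mu1 = neumann_mu1 (holder_cusp alpha) \/
            mu1 = neumann_mu1_minmax (holder_cusp alpha)) :
  ((((alpha + 1) * alpha * (2 - alpha) * (3 - alpha)) /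
    (9 * pi ^+ 3 * alpha *
     (alpha + 1 + alpha * (2 - alpha) * (3 - alpha))))%:E <= mu1)%E /\
  (alpha = 4 -> (((117 / 10 * pi ^+ 3)^-1)%:E <= mu1)%E).
Proof.
have a0 : 0 < alpha by apply: lt_trans alpha_gt1.
have pi3 : 27 <= (pi : R) ^+ 3.
  have p3 := @pi_ge3 R.
  have -> : 27 = 3 ^+ 3 :> R by ring.
  by apply: lerXn2r; rewrite ?nnegrE// (le_trans _ p3).
have p0 : 0 < (pi : R) ^+ 3 by rewrite exprn_gt0// pi_gt0.
have P := half_width_profile alpha_gt1.
have mu1_ge : ((192^-1)%:E <= mu1)%E.
  rewrite holder_cuspE// in mu1E; case: mu1E => ->.
    have O1 := strips_bounded P.
    apply: neumann_mu1_ge => //.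
      exact: measurable_strips P.
    exact: sqr_poincare_strips P.
  by apply: minmax_ge => //; exact: sqr_poincare_strips P.
split=> [|_].
  apply: le_trans mu1_ge; rewrite lee_fin.
  (* In terms of t > 0 the two cubics below are visibly positive. *)
  set t := alpha - 1.
  have t0 : 0 < t by rewrite subr_gt0.
  have aE : alpha = t + 1 by rewrite /t; ring.
  set D := alpha + 1 + alpha * (2 - alpha) * (3 - alpha).
  have D0 : 0 < D.
    have -> : D = (t + 2 / 3) * (t - 4 / 3) ^+ 2 + 76 / 27 by rewrite /D aE; field.
    by rewrite ltr_wpDl// mulr_ge0 ?sqr_ge0// addr_ge0// ltW.
  have P0 : 0 < 9 * pi ^+ 3 * alpha * D.
    by apply: mulr_gt0 => //; apply: mulr_gt0 => //; apply: mulr_gt0.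
  rewrite ler_pdivrMr//.
  have ND : (alpha + 1) * (2 - alpha) * (3 - alpha) <= 6 / 5 * D.
    rewrite -subr_ge0.
    have -> : 6 / 5 * D - (alpha + 1) * (2 - alpha) * (3 - alpha) =
        t * (1 / 5 * (t - 7 / 2) ^+ 2 + 31 / 20) + 4 / 5 by rewrite /D aE; field.
    by rewrite addr_ge0// mulr_ge0 ?(ltW t0)// addr_ge0// mulr_ge0 ?sqr_ge0.
  apply: (@le_trans _ _ (alpha * (6 / 5 * D))).
    rewrite (_ : _ * _ * _ * _ = alpha * ((alpha + 1) * (2 - alpha) * (3 - alpha))).
      by rewrite ler_pM2l.
    by ring.
  rewrite (_ : 192^-1 * _ = (9 / 192 * pi ^+ 3) * (alpha * D)); last by field.
  rewrite (_ : alpha * _ = 6 / 5 * (alpha * D)); last by ring.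
  rewrite ler_pM2r ?mulr_gt0//.
  by lra.
apply: le_trans mu1_ge; rewrite lee_fin.
rewrite lef_pV2 ?posrE//; last exact: mulr_gt0.
by lra.
Qed.
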